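(* For all integers $t\geq 3$ and $k,\ell\geq 4$: (i) $s_2(C_k,C_\ell)=3$; (ii) $s_2(K_t,C_\ell)=2(t-1)$.
   Context: All graphs are finite and simple. For graphs $H_1,\dots,H_q$, a graph $G$ is $q$-Ramsey for $(H_1,\dots,H_q)$ if every coloring of the edges of $G$ with colors $1,\dots,q$ contains, for some $i\in[q]$, a copy of $H_i$ all of whose edges have color $i$. $G$ is $q$-Ramsey-minimal for $(H_1,\dots,H_q)$ if it is $q$-Ramsey for this tuple but no proper subgraph of $G$ is. $s_q(H_1,\dots,H_q)$ denotes the minimum of the minimum degree $\delta(G)$ over all graphs $G$ that are $q$-Ramsey-minimal for $(H_1,\dots,H_q)$. $C_k$ is the cycle on $k$ vertices and $K_t$ the complete graph on $t$ vertices. *)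

(* Defs.v *)
From mathcomp Require Import all_boot.

Set Implicit Arguments.
Unset Strict Implicit.
Unset Printing Implicit Defensive.

Record sgraph := SGraph {
  vertex :> finType;
  edge : rel vertex;
  edge_sym : symmetric edge;
  edge_irrefl : irreflexive edge }.

Definition degree (G : sgraph) (x : G) : nat := #|[set y | edge x y]|.

(* Every degree is less than #|G|, so the default value of the minimum is only
   reached on the graph without vertices. *)
Definition min_degree (G : sgraph) : nat := \big[minn/#|G|]_(x : G) degree x.

Record subgraph (G : sgraph) := Subgraph {
  sub_vertices : {set G};
  sub_edge : rel G;
  sub_edge_sym : symmetric sub_edge;
  sub_edgeP : forall x y, sub_edge x y ->
    [/\ edge x y, x \in sub_vertices & y \in sub_vertices] }.

Section GraphOfSubgraph.
Variables (G : sgraph) (S : subgraph G).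

Definition subgraph_rel : rel {x : G | x \in sub_vertices S} :=
  fun x y => sub_edge S (val x) (val y).

Fact subgraph_rel_sym : symmetric subgraph_rel.
Proof. by move=> x y; apply: sub_edge_sym. Qed.

Fact subgraph_rel_irrefl : irreflexive subgraph_rel.
Proof.
by move=> x; apply/negP => /sub_edgeP[]; rewrite edge_irrefl.
Qed.

Definition graph_of_subgraph : sgraph :=
  SGraph subgraph_rel_sym subgraph_rel_irrefl.

Definition proper_subgraph : Prop :=
  sub_vertices S != setT \/ exists x y : G, edge x y /\ ~~ sub_edge S x y.

End GraphOfSubgraph.

(* A coloring is given on all sets of vertices; only its values on the pairs
   [set x; y] with edge x y matter. *)
Definition mono_copy (q : nat) (G H : sgraph) (c : {set G} -> 'I_q) (i : 'I_q)
    : Prop :=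
  exists f : H -> G, injective f /\
    forall x y : H, edge x y -> edge (f x) (f y) /\ c [set f x; f y] = i.

Definition Ramsey (q : nat) (H : 'I_q -> sgraph) (G : sgraph) : Prop :=
  forall c : {set G} -> 'I_q, exists i : 'I_q, mono_copy (H i) c i.

Definition Ramsey_minimal (q : nat) (H : 'I_q -> sgraph) (G : sgraph) : Prop :=
  Ramsey H G /\
  forall S : subgraph G, proper_subgraph S -> ~ Ramsey H (graph_of_subgraph S).

(* The relation s_q(H_1, ..., H_q) = n: the minimum exists and equals n. *)
Definition s_is (q : nat) (H : 'I_q -> sgraph) (n : nat) : Prop :=
  (exists G : sgraph, Ramsey_minimal H G /\ min_degree G = n) /\
  (forall G : sgraph, Ramsey_minimal H G -> n <= min_degree G).

Definition graph_pair (H1 H2 : sgraph) : 'I_2 -> sgraph :=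
  fun i => if i == ord0 then H1 else H2.

Definition complete_rel (t : nat) : rel 'I_t := fun i j => i != j.

Fact complete_rel_sym t : symmetric (@complete_rel t).
Proof. by move=> i j; apply: congr1 (eq_sym i j). Qed.

Fact complete_rel_irrefl t : irreflexive (@complete_rel t).
Proof. by move=> i; rewrite /complete_rel eqxx. Qed.

Definition complete (t : nat) : sgraph :=
  SGraph (@complete_rel_sym t) (@complete_rel_irrefl t).

(* ordS is the successor modulo k; this is the cycle C_k for k >= 3. *)
Definition cycle_rel (k : nat) : rel 'I_k :=
  fun i j => (i != j) && ((j == ordS i) || (i == ordS j)).

Fact cycle_rel_sym k : symmetric (@cycle_rel k).
Proof. by move=> i j; rewrite /cycle_rel eq_sym orbC. Qed.

Fact cycle_rel_irrefl k : irreflexive (@cycle_rel k).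
Proof. by move=> i; rewrite /cycle_rel eqxx. Qed.

Definition cycle_graph (k : nat) : sgraph :=
  SGraph (@cycle_rel_sym k) (@cycle_rel_irrefl k).

(* Main.v *)
(* Lower bounds.  In a minimal graph G the graph G - v has a good coloring, for
   every v.  A vertex of degree at most 2 is added back with one red and one blue
   edge.  For K_t against a cycle, the red copies of K_{t-1} in a neighbourhood
   with fewer than 2(t-1) vertices have a common vertex y, by Hajnal's lemma; one
   colors vy blue and the other edges at v red.

   Upper bounds.  Let E be a countable graph with a good coloring, and let U be E
   together with infinitely many new vertices attached to each finite set of at
   most d old ones.  If U has no good coloring, then by compactness some finite
   subgraph of U has none; deleting new vertices as long as this persists, one
   reaches a graph with a new vertex, of degree at most d, that belongs to all
   its Ramsey subgraphs, so some minimal graph has minimum degree at most d.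

   The graphs E are defined on finite sequences of integers, and the infinite
   Ramsey theorem makes each type of edge monochromatic.  Infinitely many
   vertices pairwise linked by new vertices of one color span all even cycles of
   that color, which settles even lengths.  Odd lengths rest on the shift graph
   (x_1, ..., x_m) -> (x_2, ..., x_{m+1}): its odd girth exceeds 2m, while far
   apart vertices are joined by paths of every length at least m.
   - For two odd lengths, E carries two edge types, each a shift on its own
     coordinates while the other coordinates jump.  Both types in one color
     contain every long cycle, so the types have different colors; the type with
     odd girth k + 2 is not blue if k < l.  Three far apart vertices are then
     pairwise joined by a red path of length k - 2 and a blue one of length l - 2,
     and a new vertex attached to the three closes a cycle.
   - For K_t and l even, E is the complete (t-1)-partite graph with infinite parts.
   - For K_t and l odd, the outer shift steps of E join K_t-free copies of an inner
     graph, and every coloring without blue C_l has a red K_{t-1} in every copy.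
     The outer steps are blue, since a red step type extends it to a red K_t; a
     new vertex attached to two far apart red copies of K_{t-1} is red on one of
     them or closes a blue cycle. *)

Require Import Defs.
From mathcomp Require Import all_boot.
From mathcomp Require Import boolp zify.

Set Implicit Arguments.
Unset Strict Implicit.
Unset Printing Implicit Defensive.

(** * Minimal Ramsey graphs and lower bounds *)

(** A coloring whose monochromatic copies all pass through [v] amounts to a good coloring of G - v;
    in this form it restricts to subgraphs directly. *)
Definition critical (q : nat) (H : 'I_q -> sgraph) (G : sgraph) (v : G) : Prop :=
  exists c : {set G} -> 'I_q, forall i (f : H i -> G), injective f ->
    (forall x y, edge x y -> edge (f x) (f y) /\ c [set f x; f y] = i) ->
    exists h, f h = v.

Section FiniteGraphs.
Variables (q : nat) (H : 'I_q -> sgraph).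

Lemma min_degree_le (G : sgraph) (v : G) : min_degree G <= degree v.
Proof.
rewrite /min_degree; have := mem_index_enum v.
elim: (index_enum G) => //= y s IH; rewrite big_cons inE geq_min.
by case/predU1P=> [<-|/IH ->]; rewrite ?leqnn ?orbT.
Qed.

Lemma le_min_degree (G : sgraph) (n : nat) :
  n <= #|G| -> (forall v : G, n <= degree v) -> n <= min_degree G.
Proof.
move=> nG nd; rewrite /min_degree; elim/big_ind: _ => // x y nx ny.
by rewrite leq_min nx.
Qed.

Lemma degree_lt_card (G : sgraph) (v : G) : degree v < #|G|.
Proof.
rewrite -(cardsT G) proper_card // properEneq subsetT andbT.
by apply/eqP/setP=> /(_ v); rewrite !inE edge_irrefl.
Qed.

Lemma minimal_critical (G : sgraph) (v : G) : Ramsey_minimal H G -> critical H v.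
Proof.
case=> _ minG; pose e : rel G := fun x y => [&& edge x y, x != v & y != v].
have e_sym : symmetric e by move=> x y; rewrite /e edge_sym (andbC (x != v)).
have eP x y : e x y -> [/\ edge x y, x \in [set~ v] & y \in [set~ v]].
  by case/and3P=> *; rewrite !inE; split.
have /minG/existsNP[c /forallNP nc] : proper_subgraph (Subgraph e_sym eP).
  by left; apply/eqP => /setP /(_ v); rewrite !inE eqxx.
(* A pair of [G] takes the color of its trace on G - v, so that a copy avoiding [v] is a copy in G -
   v. *)
exists (fun X : {set G} => c [set z : graph_of_subgraph (Subgraph e_sym eP) | val z \in X]).
move=> i f f_inj fP.
apply: contrapT => /forallNP fv; apply: (nc i).
have fvN h : f h \in [set~ v] by rewrite !inE; apply/eqP/fv.
pose g h : graph_of_subgraph (Subgraph e_sym eP) := Sub (f h) (fvN h).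
exists g; split=> [x y /(congr1 val)/f_inj //|x y xy].
have [exy cxy] := fP x y xy; split.
  by rewrite /= /subgraph_rel /= /e exy; move: (fvN x) (fvN y); rewrite !inE => -> ->.
by rewrite -cxy; congr c; apply/setP => z; rewrite !inE -!val_eqE.
Qed.

(** A proper Ramsey subgraph contains [v], since it has a monochromatic copy for the restriction of
    [c]. There [v] is still critical and its degree has not grown, so induction on the number of
    vertices plus ordered adjacent pairs applies. *)
Lemma critical_descent (d : nat) (G : sgraph) (v : G) :
  Ramsey H G -> critical H v -> degree v <= d ->
  exists G' : sgraph, Ramsey_minimal H G' /\ min_degree G' <= d.
Proof.
have [n] := ubnP (#|G| + #|[set p : G * G | edge p.1 p.2]|).
elim: n => // n IH in G v *; rewrite ltnS => le_n ramG [c cv] dv.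
have [minG|] := pselect (forall S : subgraph G, proper_subgraph S ->
    ~ Ramsey H (graph_of_subgraph S)).
  by exists G; split; [split|apply: leq_trans (min_degree_le v) dv].
case/existsNP=> S /not_implyP[pS /contrapT ramS].
pose c' (X : {set graph_of_subgraph S}) := c [set val z | z in X].
have c'P i (f : H i -> graph_of_subgraph S) : injective f ->
    (forall x y, edge x y -> edge (f x) (f y) /\ c' [set f x; f y] = i) ->
    exists h, val (f h) = v.
  move=> f_inj fP; apply: (cv i (fun h => val (f h))) => [x y /val_inj/f_inj //|x y xy].
  have [/sub_edgeP[exy _ _] <-] := fP x y xy; split=> //.
  by rewrite /c' imsetU1 imset_set1.
have [i [f [f_inj fP]]] := ramS c'; have [h fh] := c'P i f f_inj fP.
apply: (IH (graph_of_subgraph S) (f h)) => //; last first.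
- apply: leq_trans dv; rewrite /degree -(card_imset _ val_inj) subset_leq_card //.
  by apply/subsetP => _ /imsetP[z + ->]; rewrite !inE -fh => /sub_edgeP[].
- exists c' => j k k_inj kP; have [h' kh'] := c'P j k k_inj kP.
  by exists h'; apply: val_inj; rewrite kh' fh.
- apply: leq_trans le_n; pose E (G : sgraph) := [set p : G * G | edge p.1 p.2].
  have valE (z : graph_of_subgraph S * graph_of_subgraph S) :
      z \in E _ -> (val z.1, val z.2) \in E G /\ sub_edge S (val z.1) (val z.2).
    by rewrite !inE => zE; split=> //; case/sub_edgeP: (zE).
  have inj2 : injective (fun z : graph_of_subgraph S * graph_of_subgraph S => (val z.1, val z.2)).
    by case=> a b [a' b'] /= [/val_inj-> /val_inj->].
  have leE : #|E (graph_of_subgraph S)| <= #|E G|.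
    rewrite -(card_imset _ inj2) subset_leq_card //.
    by apply/subsetP => _ /imsetP[z /valE[zE _] ->].
  have cardS : #|graph_of_subgraph S| = #|sub_vertices S| by rewrite /= card_sig.
  rewrite cardS -addnS; case: pS => [neqT|[x [y [exy nsxy]]]].
    rewrite addnS -addSn leq_add // ltn_neqAle max_card andbT.
    by apply: contraNneq neqT => /eqP; rewrite -cardsT (subset_leqif_cards (subsetT _)).
  rewrite leq_add ?max_card // -(card_imset _ inj2) proper_card //.
  apply/properP; split; first by apply/subsetP => _ /imsetP[z /valE[zE _] ->].
  exists (x, y); rewrite ?inE //.
  by apply: contra nsxy => /imsetP[z /valE[_ zS] [-> ->]].
Qed.
End FiniteGraphs.

(** Recolor the edges at [v] by [phi]. The copy that exists for the new coloring meets [v], as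
    otherwise it would be a copy for [c] avoiding [v]. *)
Lemma mono_copy_through (q : nat) (H : 'I_q -> sgraph) (G : sgraph) (v : G)
    (c : {set G} -> 'I_q) (phi : G -> 'I_q) :
    Ramsey H G ->
    (forall i (f : H i -> G), injective f ->
      (forall x y, edge x y -> edge (f x) (f y) /\ c [set f x; f y] = i) ->
      exists h, f h = v) ->
  exists i (f : H i -> G) h, [/\ injective f, f h = v,
    forall x y, edge x y -> edge (f x) (f y),
    forall x y, x != h -> y != h -> edge x y -> c [set f x; f y] = i &
    forall y, edge h y -> phi (f y) = i].
Proof.
move=> ramG cv.
(* On an edge at [v], [pick] finds the other end; [phi v] is a dummy value. *)
pose c' (X : {set G}) := if v \in X then
  if [pick y in X :\ v] is Some y then phi y else phi v else c X.
have [i [f [f_inj fP]]] := ramG c'.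
have [h fh] : exists h, f h = v.
  apply: contrapT => /forallNP fv; have fv' x : (v == f x) = false.
    by apply/eqP => /esym/fv.
  case: (cv i f f_inj) => [x y /fP[exy] | h /fv //].
  by rewrite /c' !inE !fv'.
have fE x : (v == f x) = (x == h) by rewrite -fh (inj_eq f_inj) eq_sym.
exists i, f, h; split=> // [x y /fP[] //|x y xh yh /fP[_]|y hy].
  by rewrite /c' !inE !fE (negPf xh) (negPf yh).
have [exy] := fP _ _ hy; rewrite /c' !inE fh eqxx /=.
case: pickP => [z|/(_ (f y))]; rewrite !inE ?fh.
  by case/andP=> /negPf-> /= /eqP->.
by rewrite eqxx orbT andbT eq_sym fE => /negbFE/eqP yh; rewrite yh edge_irrefl in hy.
Qed.

(** The predicate depends on color and graph together, so that maps defined on [graph_pair H1 H2 i]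
    can be generalized before the case distinction. *)
Lemma graph_pairP (H1 H2 : sgraph) (P : 'I_2 -> sgraph -> Prop) :
  P ord0 H1 -> P (lift ord0 ord0) H2 -> forall i, P i (graph_pair H1 H2 i).
Proof.
move=> P1 P2 i; rewrite /graph_pair; have [->//|i0] := eqVneq i ord0.
by have -> : i = lift ord0 ord0 by apply: val_inj; case: i i0 => -[|[]].
Qed.

Lemma cycle_two_neighbors (n : nat) (h : cycle_graph n) : 3 <= n ->
  exists a b : cycle_graph n, [/\ edge h a, edge h b & a != b].
Proof.
case: n h => // n h n3; exists (ordS h), (ord_pred h).
have hS : h != ordS h.
  rewrite -val_eqE /=; have := ltn_ord h; case: (ltnP h.+1 n.+1) => [lt|le] hn.
    by rewrite modn_small //; lia.
  have -> : h.+1 = n.+1 by lia.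
  by rewrite modnn; lia.
have hSS : ordS (ordS h) != h.
  rewrite -val_eqE /=; have := ltn_ord h; case: (ltnP h.+1 n.+1) => [lt|le] hn.
    rewrite (modn_small lt); case: (ltnP h.+2 n.+1) => [lt2|le2].
      by rewrite modn_small //; lia.
    have -> : h.+2 = n.+1 by lia.
    by rewrite modnn; lia.
  have -> : h.+1 = n.+1 by lia.
  by rewrite modnn modn_small //; lia.
split; rewrite /= /cycle_rel.
- by rewrite hS eqxx.
- rewrite ord_predK eqxx orbT andbT; apply: contraNneq hS => h'.
  by rewrite {2}h' ord_predK.
- apply: contra_neq hSS => ->; exact: ord_predK.
Qed.

(** With at most two edges at [v], one red and the other blue, no cycle of one color can pass
    through [v]. *)
Lemma cycles_le_min_degree (k l : nat) (G : sgraph) : 3 <= k -> 3 <= l ->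
  Ramsey_minimal (graph_pair (cycle_graph k) (cycle_graph l)) G -> 3 <= min_degree G.
Proof.
move=> k3 l3 minG.
have two i (h : graph_pair (cycle_graph k) (cycle_graph l) i) :
    exists a b, [/\ edge h a, edge h b & a != b].
  move: h; apply: (@graph_pairP _ _ (fun _ H => forall h : H,
    exists a b, [/\ edge h a, edge h b & a != b])) => h; exact: cycle_two_neighbors.
have deg (v : G) : 3 <= degree v.
  rewrite leqNgt; apply/negP => dv; have [ramG _] := minG.
  have [c cv] := minimal_critical v minG.
  pose y0 := odflt v [pick y in [set y | edge v y]].
  pose phi y : 'I_2 := if y == y0 then ord0 else lift ord0 ord0.
  have [i [f [h [f_inj fh fe _ fphi]]]] := mono_copy_through phi ramG cv.
  have [a [b [ha hb ab]]] := two i h.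
  have Na : f a \in [set y | edge v y] by rewrite inE -fh fe.
  have Nb : f b \in [set y | edge v y] by rewrite inE -fh fe.
  have fab : f a != f b by rewrite (inj_eq f_inj).
  have Ny0 : y0 \in [set y | edge v y].
    by rewrite /y0; case: pickP => // /(_ (f a)); rewrite Na.
  have : phi (f a) = phi (f b) by rewrite !fphi.
  rewrite /phi; case: eqP => [ay|/eqP ay]; case: eqP => [bj|/eqP bj] //.
    by move: fab; rewrite ay bj eqxx.
  move=> _; have : #|y0 |: [set f a; f b]| <= degree v.
    by rewrite subset_leq_card // !subUset !sub1set Ny0 Na.
  by rewrite cardsU1 cards2 fab !inE ![y0 == _]eq_sym (negPf ay) (negPf bj); lia.
have G0 : 0 < #|G|.
  have [ramG _] := minG; have [i [f _]] := ramG (fun=> ord0).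
  have [h _] : exists h : graph_pair (cycle_graph k) (cycle_graph l) i, h = h.
    move: {f} i; apply: (@graph_pairP _ _ (fun _ H => exists h : H, h = h)).
      by exists (Ordinal (ltn_trans (erefl (0 < 2)) k3)).
    by exists (Ordinal (ltn_trans (erefl (0 < 2)) l3)).
  by apply/card_gt0P; exists (f h).
apply: (le_min_degree _ deg).
have [v _] := card_gt0P G0.
exact: leq_trans (deg v) (ltnW (degree_lt_card v)).
Qed.


(* Hajnal's lemma: if [U] is the union and [I] the intersection of the maximum
   cliques treated so far, then [(A :&: U) :|: I] is a clique for the next
   clique [A], which keeps [#|U| + #|I|] at least [2 * w]. *)
Lemma hajnal (T : finType) (e : rel T) (N : {set T}) (w : nat) (C : seq {set T}) :
  symmetric e ->
  (forall Q : {set T}, Q \subset N -> {in Q &, forall x y, x != y -> e x y} -> #|Q| <= w) ->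
  (forall A, A \in C -> [/\ A \subset N, {in A &, forall x y, x != y -> e x y} & #|A| = w]) ->
  #|N| < 2 * w -> C != [::] -> exists y, forall A, A \in C -> y \in A.
Proof.
move=> e_sym Nw CP Nlt C0.
suff [U [I [UN IU adj Cin le_w]]] : exists U I : {set T}, [/\ U \subset N, I \subset U,
    forall x y, x \in I -> y \in U -> x != y -> e x y,
    forall A, A \in C -> (A \subset U) && (I \subset A) & 2 * w <= #|U| + #|I|].
  have /card_gt0P[y yI] : 0 < #|I| by have := subset_leq_card UN; lia.
  by exists y => A /Cin/andP[_ /subsetP]; apply.
elim: C C0 CP => // A [|A' C] IH _ CP.
  have [AN Acl Aw] := CP A (mem_head _ _); exists A, A; split=> //.
  - by move=> B; rewrite inE => /eqP->; rewrite subxx.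
  - by rewrite Aw mulSn mul1n.
have [|B BC|U [I [UN IU adj Cin le_w]]] := IH _ _; first by [].
  by apply: CP; rewrite inE BC orbT.
have [AN Acl Aw] := CP A (mem_head _ _).
exists (A :|: U), (A :&: I); split.
- by rewrite subUset AN.
- by rewrite subIset // subsetUl.
- move=> x y /setIP[xA xI] /setUP[yA|yU] xy; [exact: Acl | exact: adj].
- move=> B; rewrite inE => /predU1P[->|/Cin/andP[BU IB]].
    by rewrite subsetUl subsetIl.
  by rewrite (subset_trans BU (subsetUr _ _)) (subset_trans (subsetIr _ _) IB).
have QU : (A :&: U) :|: I \subset U by rewrite subUset subsetIr.
have := Nw ((A :&: U) :|: I) (subset_trans QU UN).
have cl : {in (A :&: U) :|: I &, forall x y, x != y -> e x y}.
  move=> x y /setUP[/setIP[xA xU]|xI] /setUP[/setIP[yA yU]|yI] xy.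
  - exact: Acl.
  - by rewrite e_sym; apply: adj; rewrite // eq_sym.
  - exact: adj.
  - by apply: adj => //; exact: (subsetP IU).
move=> /(_ cl); have := cardsUI (A :&: U) I; have := cardsUI A U.
have -> : A :&: U :&: I = A :&: I by rewrite -setIA (setIidPr IU).
rewrite Aw; lia.
Qed.

Lemma complete_cycle_le_min_degree (t l : nat) (G : sgraph) : 2 <= t -> 3 <= l ->
  Ramsey_minimal (graph_pair (complete t) (cycle_graph l)) G -> 2 * (t - 1) <= min_degree G.
Proof.
move=> t2 l3 minG; have [ramG _] := minG.
have deg (v : G) : 2 * (t - 1) <= degree v.
  rewrite leqNgt; apply/negP => dv.
  have [c cv] := minimal_critical v minG.
  pose N := [set y | edge v y].
  pose e : rel G := fun x y => edge x y && (c [set x; y] == ord0).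
  have e_sym : symmetric e by move=> x y; rewrite /e edge_sym setUC.
  pose clique (Q : {set G}) := [forall x in Q, forall y in Q, (x != y) ==> e x y].
  have cliqueP (Q : {set G}) : reflect {in Q &, forall x y, x != y -> e x y} (clique Q).
    apply: (iffP forall_inP) => [h x y xQ yQ xy|h x xQ].
      by have /forall_inP/(_ y yQ)/implyP := h x xQ; apply.
    by apply/forall_inP => y yQ; apply/implyP/h.
  (* A red clique on [t] vertices inside [N] would be a copy of the complete graph that avoids
     [v]. *)
  have small (Q : {set G}) : Q \subset N -> {in Q &, forall x y, x != y -> e x y} -> #|Q| <= t - 1.
    move=> QN Qcl; rewrite leqNgt; apply/negP => Qt.
    have tQ : t <= #|Q| by lia.
    pose f (i : complete t) : G := enum_val (widen_ord tQ i).
    have f_inj : injective f.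
      by move=> i j /enum_val_inj/(congr1 val) ij; apply: val_inj.
    have [||h fh] := cv ord0 f _ _ => //.
      move=> x y xy; have := Qcl (f x) (f y) (enum_valP _) (enum_valP _).
      by rewrite (inj_eq f_inj) => /(_ xy)/andP[-> /eqP->].
    have := subsetP QN (f h) (enum_valP _).
    by rewrite fh inE edge_irrefl.
  pose C := [seq Q : {set G} <- enum {set G} | [&& Q \subset N, clique Q & #|Q| == t - 1]].
  have [y0 y0P] : exists y0, forall Q : {set G}, Q \in C -> y0 \in Q.
    (* Without red cliques on [t - 1] vertices in [N], the choice [v] makes every edge at [v]
       red. *)
    have [->|C0] := eqVneq C [::]; first by exists v.
    apply: (hajnal e_sym small _ _ C0) => // Q.
    by rewrite mem_filter => /andP[/and3P[-> /cliqueP ? /eqP ->]].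
  (* At most one edge at [v] is blue, too few for a blue cycle; a red complete graph through [v]
     would leave a red clique on [t - 1] neighbours without [y0]. *)
  pose phi y : 'I_2 := if y == y0 then lift ord0 ord0 else ord0.
  have [i [f [h [f_inj fh fe fc fphi]]]] := mono_copy_through phi ramG cv.
  have [i0|i0] := eqVneq i ord0.
    move: f h f_inj fh fe fc fphi; rewrite i0 /graph_pair eqxx => f h f_inj fh fe fc fphi.
    pose Q := [set f x | x in [set~ h]].
    have : Q \in C.
      rewrite mem_filter mem_enum andbT; apply/and3P; split.
      - apply/subsetP => _ /imsetP[x xh ->]; rewrite inE -fh fe //.
        by move: xh; rewrite !inE eq_sym.
      - apply/cliqueP => _ _ /imsetP[x xh ->] /imsetP[y yh ->]; rewrite (inj_eq f_inj) => xy.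
        by rewrite /e fe // fc //; [move: xh | move: yh]; rewrite !inE.
      - by rewrite card_imset // cardsC1 card_ord subn1.
    move=> /y0P/imsetP[x xh y0x].
    have hx : edge h x by move: xh; rewrite !inE eq_sym.
    by have := fphi x hx; rewrite /phi y0x eqxx.
  have : exists a b, [/\ edge h a, edge h b & a != b].
    move: h {fh fe fc fphi}; rewrite /graph_pair (negPf i0) => h.
    exact: cycle_two_neighbors.
  case=> a [b [ha hb ab]].
  have fab : f a != f b by rewrite (inj_eq f_inj).
  have : phi (f a) = i by apply: fphi.
  have : phi (f b) = i by apply: fphi.
  rewrite /phi; case: eqP => [bj|_ i']; last by rewrite -i' eqxx in i0.
  case: eqP => [aj _ _|_ _ i']; last by rewrite -i' eqxx in i0.
  by rewrite aj bj eqxx in fab.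
have G0 : 0 < #|G|.
  have [i [f _]] := ramG (fun=> ord0).
  have [h _] : exists h : graph_pair (complete t) (cycle_graph l) i, h = h.
    move: {f} i; apply: (@graph_pairP _ _ (fun _ H => exists h : H, h = h)).
      by exists (Ordinal (ltnW t2)).
    by exists (Ordinal (ltn_trans (erefl (0 < 2)) l3)).
  by apply/card_gt0P; exists (f h).
apply: (le_min_degree _ deg).
have [v _] := card_gt0P G0.
exact: leq_trans (deg v) (ltnW (degree_lt_card v)).
Qed.

(** * Reduction of the upper bounds to countable graphs *)

Definition hcopy (H : sgraph) (V : Type) (R : rel V) : Prop :=
  exists f : H -> V, injective f /\ forall x y, edge x y -> R (f x) (f y).

(** The colors may overlap and contain non-edges; this does not change the notion, since copies
    survive when a relation grows. [E] need not be symmetric: an edge is listed in at least one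
    direction. *)
Definition arrows (V : Type) (E : rel V) (H1 H2 : sgraph) : Prop :=
  forall R B : rel V, symmetric R -> symmetric B ->
    (forall x y, E x y -> R x y || B x y) -> hcopy H1 R \/ hcopy H2 B.

(* [inr (A, n)] is the [n]-th new vertex attached to the members of [A]; it is
   isolated when [A] is too long. *)
Definition fresh_rel (d : nat) (V : eqType) (E : rel V) : rel (V + seq V * nat) :=
  fun u v => match u, v with
  | inl x, inl y => E x y
  | inl x, inr p => (x \in p.1) && (size p.1 <= d)
  | _, _ => false
  end.

Lemma arrowsC (V : Type) (E : rel V) (H1 H2 : sgraph) :
  arrows E H1 H2 -> arrows E H2 H1.
Proof.
move=> a R B Rs Bs cov.
by case: (a B R Bs Rs _) => [x y /cov|h|h]; [rewrite orbC | right | left].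
Qed.

(** Diagonal argument: [X n] is a decreasing chain of infinite index sets, and on [X n] the colors
    of all elements with code below [n] are constant. *)
Lemma limit_coloring (T : countType) (c : nat -> T -> bool) :
  exists b : T -> bool, forall (s : seq T) (M : nat),
    exists2 N, M <= N & {in s, c N =1 b}.
Proof.
pose infinite (X : nat -> Prop) := forall M, exists2 N, M <= N & X N.
pose C n N := if unpickle n is Some x then c N x else false.
pose split_at (X : nat -> Prop) n : bool := `[<infinite (fun N => X N /\ C n N)>].
pose X := fix X n : nat -> Prop := if n is m.+1
  then fun N => X m N /\ C m N = split_at (X m) m else fun=> True.
have infX n : infinite (X n).
  elim: n => [M|n IH M]; first by exists M.
  rewrite /=; case: (boolP (split_at (X n) n)) => [/asboolP/(_ M)[N MN XN]|/asboolP].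
    by exists N.
  case/existsNP=> M0 /forall2NP noM0.
  have [N] := IH (maxn M M0); rewrite geq_max => /andP[MN M0N] XN.
  exists N; rewrite //; split=> //; apply/negbTE/negP => CN.
  by case: (noM0 N) => // -[].
have subX n m N : n <= m -> X m N -> X n N.
  by move/subnK <-; elim: (m - n) => //= k IH [/IH].
exists (fun x => split_at (X (pickle x)) (pickle x)) => s M.
pose n := \max_(x <- s) (pickle x).+1.
have [N MN XN] := infX n M; exists N => // x xs.
have : X (pickle x).+1 N by apply: subX XN; rewrite /n (big_rem x) //= leq_maxl.
by rewrite /= /C pickleK => -[].
Qed.

(** Otherwise every finite stage [X n] has a good coloring. A copy in a limit of these uses finitely
    many pairs, on which the limit agrees with the coloring of a late stage that contains its
    vertices. *)
Lemma arrows_compact (V : countType) (E : rel V) (H1 H2 : sgraph) :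
  arrows E H1 H2 ->
  exists X : seq V, arrows [rel x y | [&& x \in X, y \in X & E x y]] H1 H2.
Proof.
move=> arrE; apply: contrapT => /forallNP noX.
pose X n : seq V := pmap unpickle (iota 0 n).
have memX n x : pickle x < n -> x \in X n.
  by move=> xn; rewrite mem_pmap -(pickleK x) map_f // mem_iota.
have bad n : exists p : rel V * rel V,
    [/\ symmetric p.1, symmetric p.2,
      forall x y, [&& x \in X n, y \in X n & E x y] -> p.1 x y || p.2 x y,
      ~ hcopy H1 p.1 & ~ hcopy H2 p.2].
  have /existsNP[R /existsNP[B /not_implyP[Rs /not_implyP[Bs /not_implyP[cov]]]]] := noX (X n).
  by case/not_orP=> *; exists (R, B); split.
have [p pP] := choice bad.
have [b bP] := limit_coloring (fun n (z : V * V) => (p n).1 z.1 z.2).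
(* Only red passes to the limit; blue is defined as the remaining edges. *)
pose R x y := b (x, y); pose B x y := (E x y || E y x) && ~~ R x y.
have Rs : symmetric R.
  move=> x y; have [N _ Nb] := bP [:: (x, y); (y, x)] 0; have [ps _ _ _ _] := pP N.
  by rewrite /R -!Nb ?inE ?eqxx ?orbT //= ps.
have Bs : symmetric B by move=> x y; rewrite /B orbC Rs.
have cover x y : E x y -> R x y || B x y by rewrite /B => ->; case: (R x y).
have lift (H : sgraph) (f : H -> V) : exists N, (forall x y, b (f x, f y) = (p N).1 (f x) (f y)) /\
    forall x, f x \in X N.
  pose s := [seq (f x, f y) | x <- enum H, y <- enum H].
  have [N MN Nb] := bP s (\max_(x : H) (pickle (f x)).+1).
  exists N; split=> [x y|x].
    by rewrite -Nb //; apply/allpairsP; exists (x, y); rewrite !mem_enum.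
  by apply: memX; apply: leq_trans MN; apply: (leq_bigmax x).
case: (arrE R B Rs Bs cover) => -[f [f_inj fP]]; have [N [Nb NX]] := lift _ f;
  have [ps qs cov n1 n2] := pP N.
  by apply: n1; exists f; split=> // x y /fP; rewrite /R Nb.
apply: n2; exists f; split=> // x y /fP; rewrite /B /R Nb => /andP[].
move=> /orP[] Exy /negPf pN; have := cov _ _ (introT and3P (And3 (NX _) (NX _) Exy)).
  by rewrite pN.
by rewrite ps pN qs.
Qed.

Definition is_fresh (A B : Type) (u : A + B) : bool := if u is inr _ then true else false.

Section Reduction.
Variables (V : countType) (E : rel V) (H1 H2 : sgraph) (d : nat).
Hypothesis E_irr : irreflexive E.
Hypotheses (H1_deg : forall x : H1, exists y, edge x y).
Hypotheses (H2_deg : forall x : H2, exists y, edge x y).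
Hypotheses (notE : ~ arrows E H1 H2) (arrU : arrows (fresh_rel d E) H1 H2).

Local Notation U := (V + seq V * nat)%type.
Local Notation EU := (fresh_rel d E).
Local Notation restr X := [rel x y : U | [&& x \in X, y \in X & EU x y]].

(** Compactness gives a finite arrowing set. Deleting its new vertices one by one must fail at some
    point, since a set of old vertices only would show that [E] arrows. *)
Lemma strip_fresh : exists (X : seq U) (v : U), [/\ v \in X, is_fresh v,
  arrows (restr X) H1 H2 & ~ arrows (restr (filter (predC1 v) X)) H1 H2].
Proof.
have [X] := arrows_compact arrU.
have [n] := ubnP (size X); elim: n X => // n IH X; rewrite ltnS => Xn arrX.
have [[v [vX vf arrv]]|no] := pselect (exists v, [/\ v \in X, is_fresh v &
    arrows (restr (filter (predC1 v) X)) H1 H2]).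
  apply: IH arrv; apply: leq_trans Xn; rewrite size_filter.
  rewrite -(count_predC (pred1 v) X) -[X in X < _]add0n ltn_add2r.
  by rewrite -has_count has_pred1.
have [[v [vX vf]]|no'] := pselect (exists v, v \in X /\ is_fresh v).
  by exists X, v; split=> // arrv; apply: no; exists v.
case: notE => R B Rs Bs cov.
pose ext (r : rel V) : rel U := fun u v =>
  if u is inl x then if v is inl y then r x y else false else false.
have exts r : symmetric r -> symmetric (ext r) by move=> rs [x|x] [y|y] //=.
have extP (H : sgraph) r : (forall x : H, exists y, edge x y) -> hcopy H (ext r) -> hcopy H r.
  move=> Hd [f [f_inj fP]].
  have /choice[g gP] x : exists y, f x = inl y.
    by have [y /fP] := Hd x; case: (f x) => // a _; exists a.
  exists g; split=> [x y gxy|x y /fP]; last by rewrite !gP.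
  by apply: f_inj; rewrite !gP gxy.
case: (arrX (ext R) (ext B) (exts _ Rs) (exts _ Bs)).
- move=> [x|p] [y|q] /and3P[xX yX] //= Exy; first exact: cov.
  by case: no'; exists (inr q).
- by left; apply: extP.
- by right; apply: extP.
Qed.

(** In the finite graph spanned by [X] the new vertex [v] is critical, as [X] without [v] has a good
    coloring, and its degree is at most [d]; [critical_descent] then reaches a minimal graph. *)
Theorem exists_minimal_small_degree : exists G : sgraph,
  Ramsey_minimal (graph_pair H1 H2) G /\ min_degree G <= d.
Proof.
have [X [v [vX vf arrX narr]]] := strip_fresh.
pose W : finType := seq_sub X.
pose e : rel W := fun x y => EU (val x) (val y) || EU (val y) (val x).
have e_sym : symmetric e by move=> x y; rewrite /e orbC.
have e_irr : irreflexive e.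
  by move=> x; rewrite /e orbb; case: (val x) => //= y; rewrite E_irr.
pose G := SGraph e_sym e_irr; pose v' : G := SeqSub vX.
have H_deg i : forall x : graph_pair H1 H2 i, exists y, edge x y.
  by apply: (@graph_pairP _ _ (fun _ H => forall x : H, exists y, edge x y)).
apply: (@critical_descent _ _ _ G v').
- move=> c.
  pose r (P : pred 'I_2) : rel U := fun x y =>
    [exists a : G, exists b : G, [&& val a == x, val b == y, edge a b & P (c [set a; b])]].
  have rs P : symmetric (r P).
    suff h x y : r P x y -> r P y x by move=> x y; apply/idP/idP; apply: h.
    case/existsP=> a /existsP[b /and4P[ax b_y ab Pc]]; apply/existsP; exists b.
    by apply/existsP; exists a; rewrite ax b_y edge_sym ab setUC.
  have rP i (P : pred 'I_2) : (forall j, P j -> j = i) ->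
      hcopy (graph_pair H1 H2 i) (r P) -> mono_copy (graph_pair H1 H2 i) c i.
    move=> Pi [f [f_inj fP]].
    have /choice[g gP] x : exists a : G, f x = val a.
      by have [y /fP/existsP[a /existsP[b /and4P[/eqP <- _ _ _]]]] := H_deg i x; exists a.
    exists g; split=> [x y gxy|x y /fP/existsP[a /existsP[b /and4P[]]]].
      by apply: f_inj; rewrite !gP gxy.
    by rewrite !gP => /eqP/val_inj-> /eqP/val_inj-> -> /Pi.
  case: (arrX (r (pred1 ord0)) (r (predC1 ord0)) (rs _) (rs _)).
  + move=> x y /and3P[xX yX xy]; pose a : G := SeqSub xX; pose b : G := SeqSub yX.
    have eab : edge a b by rewrite /= /e /= xy.
    have [c0|c0] := boolP (c [set a; b] == ord0).
      by apply/orP; left; apply/existsP; exists a; apply/existsP; exists b; rewrite !eqxx eab.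
    by apply/orP; right; apply/existsP; exists a; apply/existsP; exists b; rewrite !eqxx eab.
  + by move=> h; exists ord0; apply: (rP ord0 (pred1 ord0) _ h) => j /eqP.
  + move=> h; exists (lift ord0 ord0); apply: (rP (lift ord0 ord0) (predC1 ord0) _ h).
    by case=> -[|[|//]] // i _; apply: val_inj.
- have /existsNP[R /existsNP[B /not_implyP[Rs /not_implyP[Bs /not_implyP[cov]]]]] := narr.
  move=> /not_orP[nR nB].
  pose c (Z : {set G}) : 'I_2 :=
    if [exists a : G, exists b : G, (Z == [set a; b]) && R (val a) (val b)]
    then ord0 else lift ord0 ord0.
  have cE x y : (c [set x; y] == ord0) = R (val x) (val y).
    rewrite /c; case: ifPn => [/existsP[a /existsP[b /andP[/eqP ab Rab]]]|].
      have : a \in [set x; y] by rewrite ab !inE eqxx.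
      have : b \in [set x; y] by rewrite ab !inE eqxx orbT.
      have : x \in [set a; b] by rewrite -ab !inE eqxx.
      have : y \in [set a; b] by rewrite -ab !inE eqxx orbT.
      rewrite !inE => /orP[]/eqP-> /orP[]/eqP-> /orP[]/eqP h1 /orP[]/eqP h2;
        by apply/esym; move: Rab; rewrite ?h1 ?h2 // Rs.
    move=> no; rewrite eqE /=; apply/esym/negbTE; apply: contra no => Rxy.
    by apply/existsP; exists x; apply/existsP; exists y; rewrite eqxx.
  exists c => i f f_inj fP; apply: contrapT => /forallNP fv.
  have fvX x : val (f x) \in filter (predC1 v) X.
    rewrite mem_filter ssvalP andbT /=; apply/eqP => fxv; apply: (fv x).
    exact: val_inj.
  move: i f f_inj fP {fv} fvX; apply: (@graph_pairP H1 H2 (fun i H => forall f : H -> G,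
      injective f -> (forall x y, edge x y -> edge (f x) (f y) /\ c [set f x; f y] = i) ->
      (forall x, val (f x) \in filter (predC1 v) X) -> False)) => f f_inj fP fvX.
    apply: nR; exists (fun x => val (f x)); split=> [x y /val_inj/f_inj//|x y /fP[_ /eqP]].
    by rewrite cE.
  apply: nB; exists (fun x => val (f x)); split=> [x y /val_inj/f_inj//|x y /fP[exy cxy]].
  have nRxy : R (val (f x)) (val (f y)) = false by rewrite -cE cxy.
  case/orP: exy => exy; have := cov _ _ (introT and3P (And3 (fvX _) (fvX _) exy)).
    by rewrite nRxy.
  by rewrite Rs nRxy Bs.
- have v'E : val v' = v by [].
  clearbody v'; case: v vf v'E {vX arrX narr} => // -[A n] _ v'E.
  (* The neighbours of a new vertex are members of its list [A]; if [A] is too long there are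
     none. *)
  rewrite /degree; have [Ad|Ad] := leqP (size A) d.
    apply: leq_trans Ad; rewrite cardE -(size_map (val : G -> U)) -(size_map (inl : V -> U) A).
    apply: uniq_leq_size; first by rewrite map_inj_uniq ?enum_uniq //; apply: val_inj.
    move=> _ /mapP[y + ->]; rewrite mem_enum inE /= /e v'E /=.
    by case: (val y) => //= x /andP[xA _]; apply: map_f.
  rewrite (_ : finset _ = set0) ?cards0 //; apply/setP => y; rewrite !inE /= /e v'E /=.
  by case: (val y) => //= x; rewrite leqNgt Ad andbF.
Qed.

End Reduction.

(** * The infinite Ramsey theorem *)

Section RamseyTheorem.

Let infinite (X : nat -> Prop) := forall M, exists2 N, M < N & X N.
Let homogeneous r (P : seq nat -> Prop) (X : nat -> Prop) (b : bool) :=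
  forall s, sorted ltn s -> size s = r -> {in s, forall x, X x} -> P s <-> b.

(** Each stage takes an element [a] of the current infinite set and thins out the rest until the
    color of [a :: s] no longer depends on [s]. Infinitely many stages share a color, and their
    elements form [Y]. *)
Let ramsey_infinite r : forall P X, infinite X ->
  exists Y b, [/\ infinite Y, forall x, Y x -> X x & homogeneous r P Y b].
Proof.
elim: r => [|r IH] P X infX.
  exists X, `[<P [::]>]; split=> // -[] // _ _ _.
  by split=> [?|/asboolP //]; apply/asboolP.
have step (Z : {Z | infinite Z}) : exists p : nat * {Z | infinite Z} * bool,
    [/\ sval Z p.1.1, forall x, sval p.1.2 x -> sval Z x /\ p.1.1 < x &
      homogeneous r (fun s => P (p.1.1 :: s)) (sval p.1.2) p.2].
  case: Z => Z infZ; have [a _ Za] := infZ 0.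
  have infZa : infinite (fun x => Z x /\ a < x).
    move=> M; have [N] := infZ (maxn M a); rewrite gtn_max => /andP[MN aN] ZN.
    by exists N.
  have [Y [b [infY YZ Yb]]] := IH (fun s => P (a :: s)) _ infZa.
  by exists (a, exist _ Y infY, b).
have [F FP] := choice step.
(* [a n] is the element taken from [Xn n], and [b n] the color of the sets that start with [a n] and
   continue in [Xn n.+1]. *)
pose Xn := fix Xn n := if n is m.+1 then (F (Xn m)).1.2 else exist _ X infX.
pose a n := (F (Xn n)).1.1; pose b n := (F (Xn n)).2.
have subX n m x : n <= m -> sval (Xn m) x -> sval (Xn n) x.
  move/subnK <-; elim: (m - n) => //= k Hk xk; apply: Hk.
  by have [_ /(_ x xk)[]] := FP (Xn (k + n)).
have aX n m : n <= m -> sval (Xn n) (a m).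
  by move=> nm; apply: (subX _ _ _ nm); have [] := FP (Xn m).
have a_lt n m : n < m -> a n < a m.
  by move=> nm; have [_ /(_ (a m) (aX _ _ nm))[]] := FP (Xn n).
have a_ge n : n <= a n by elim: n => // n Hn; apply: leq_ltn_trans Hn (a_lt _ _ _).
have [c infc] : exists c, forall M, exists2 N, M < N & b N = c.
  have [inft|/existsNP[M noM]] := pselect (forall M, exists2 N, M < N & b N = true).
    by exists true.
  exists false => M'; exists (maxn M M').+1; first by rewrite ltnS leq_maxr.
  case E: (b _) => //; case: noM; exists (maxn M M').+1 => //.
  by rewrite ltnS leq_maxl.
exists (fun x => exists2 n, x = a n & b n = c), c; split.
- move=> M; have [N MN bN] := infc M; exists (a N); last by exists N.
  exact: leq_trans MN (a_ge N).
- by move=> _ [n -> _]; apply: (aX 0).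
- case=> // x s; rewrite /= => ss [sr] Ys.
  have [n xE bn] := Ys x (mem_head _ _).
  have [_ _ /(_ s)] := FP (Xn n); rewrite -/(a n) -/(b n) bn -xE; apply=> //.
    exact: path_sorted ss.
  move=> y ys; have xy : x < y.
    by move: ss; rewrite (path_sortedE ltn_trans) => /andP[/allP/(_ y ys)].
  have [|m yE _] := Ys y; first by rewrite inE ys orbT.
  rewrite yE -/(Xn n.+1); apply: aX.
  by rewrite ltnNge; apply: contraL xy => mn; rewrite -leqNgt xE yE;
    move: mn; rewrite leq_eqVlt => /predU1P[->//|/a_lt/ltnW].
Qed.

(** The homogeneous set is given as the range of an increasing [g], so that vertices which are
    sequences can be moved into it entry by entry. *)
Theorem ramsey r (P : seq nat -> Prop) :
  exists g : nat -> nat, {homo g : x y / x < y} /\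
    ((forall s, sorted ltn s -> size s = r -> P (map g s)) \/
     (forall s, sorted ltn s -> size s = r -> ~ P (map g s))).
Proof.
have infT : infinite (fun=> True) by move=> M; exists M.+1.
have [Y [b [infY _ Yb]]] := ramsey_infinite r P infT.
have /choice[nxt nxtP] M : exists N, M < N /\ Y N by have [N] := infY M; exists N.
pose g n := iter n.+1 nxt 0.
have g_homo : {homo g : x y / x < y}.
  by apply: homo_ltn => [y x z|n]; [exact: ltn_trans|have [] := nxtP (g n)].
have gY n : Y (g n) by have [] := nxtP (iter n nxt 0).
have sP s : sorted ltn s -> size s = r -> P (map g s) <-> b.
  move=> ss sr; apply: Yb; rewrite ?size_map //.
    by rewrite sorted_map; apply: sub_sorted ss => x y; apply: g_homo.
  by move=> _ /mapP[x _ ->].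
exists g; split=> //; case: (b) sP => sP; [left|right] => s ss sr.
  exact/sP.
by move/(sP s ss sr).
Qed.

End RamseyTheorem.

Lemma homo_ltn_comp (g h : nat -> nat) : {homo g : x y / x < y} ->
  {homo h : x y / x < y} -> {homo g \o h : x y / x < y}.
Proof. by move=> g_homo h_homo x y xy; apply/g_homo/h_homo. Qed.

Lemma homo_ltn_inj (g : nat -> nat) : {homo g : x y / x < y} -> injective g.
Proof. by move=> g_homo; apply: incn_inj; apply: leq_mono. Qed.

Lemma sorted_ltn_map (g : nat -> nat) s : {homo g : x y / x < y} ->
  sorted ltn s -> sorted ltn (map g s).
Proof.
by move=> g_homo; rewrite sorted_map; apply: sub_sorted => x y; apply: g_homo.
Qed.

Lemma ramsey_family (I : eqType) (t : seq I) r (P : I -> seq nat -> Prop) :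
  exists g : nat -> nat, {homo g : x y / x < y} /\
    {in t, forall i, (forall s, sorted ltn s -> size s = r -> P i (map g s)) \/
                     (forall s, sorted ltn s -> size s = r -> ~ P i (map g s))}.
Proof.
elim: t => [|i t [g [g_homo gP]]]; first by exists id; split.
have [h [h_homo hP]] := ramsey r (fun s => P i (map g s)).
exists (g \o h); split; first exact: homo_ltn_comp.
move=> j; rewrite inE => /predU1P[->|/gP[] jP].
- by case: hP => H; [left|right] => s ss sr; rewrite map_comp; apply: H.
- left=> s ss sr; rewrite map_comp; apply: jP; rewrite ?size_map //.
  exact: sorted_ltn_map.
- right=> s ss sr; rewrite map_comp; apply: jP; rewrite ?size_map //.
  exact: sorted_ltn_map.
Qed.

(** * Cycles and shift graphs *)

Lemma cycle_no_isolated n : 3 <= n -> forall x : cycle_graph n, exists y, edge x y.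
Proof. by move=> n3 x; have [a [_ [xa _ _]]] := cycle_two_neighbors x n3; exists a. Qed.

Lemma complete_no_isolated n : 2 <= n -> forall x : complete n, exists y, edge x y.
Proof.
move=> n2 x; have [y xy|] := pickP (fun y : 'I_n => x != y); first by exists y.
move=> no; have := card_ord n; rewrite (eq_card (_ : _ =i pred1 x)) ?card1 => [|y]; first lia.
by move: (no y); rewrite !inE eq_sym => /negbFE ->.
Qed.

Lemma hcopy_cycle (V : Type) (R : rel V) (n : nat) (p : nat -> V) : symmetric R ->
  (forall i j, i < n -> j < n -> p i = p j -> i = j) ->
  (forall i, i.+1 < n -> R (p i) (p i.+1)) -> R (p n.-1) (p 0) ->
  hcopy (cycle_graph n) R.
Proof.
move=> Rs p_inj pR pR0; exists (fun i : 'I_n => p i); split.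
  by move=> i j /p_inj ij; apply: val_inj; apply: ij.
have step (i j : 'I_n) : j == ordS i -> R (p i) (p j).
  rewrite -val_eqE /= => /eqP->; have := ltn_ord i; case: (ltnP i.+1 n) => [lt|le] hi.
    by rewrite modn_small // pR.
  have -> : i.+1 = n by lia.
  by rewrite modnn (_ : i = n.-1 :> nat) //; lia.
by move=> i j /andP[_ /orP[/step //|/step]]; rewrite Rs.
Qed.

(** Periodic indexing replaces arithmetic modulo [n]. Injectivity is dropped because the odd girth
    argument works for closed walks. *)
Lemma cycle_walk (V : Type) (R : rel V) (n : nat) : 3 <= n -> hcopy (cycle_graph n) R ->
  exists x : nat -> V, (forall i, x (i + n) = x i) /\ forall i, R (x i) (x i.+1).
Proof.
case: n => // n n3 [f [_ fP]]; exists (fun i => f (inord (i %% n.+1))); split=> i.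
  by rewrite modnDr.
apply: fP; rewrite /= /cycle_rel; set a := inord _; set b := inord _.
have ba : b = ordS a.
  apply: val_inj; rewrite /= !inordK ?ltn_pmod //.
  by rewrite -addn1 -(addn1 (i %% _)) modnDml.
rewrite ba eqxx andbT -val_eqE /=; have := ltn_ord a.
case: (ltnP a.+1 n.+1) => [lt|le] ha; first by rewrite modn_small //; lia.
have -> : a.+1 = n.+1 by lia.
by rewrite modnn; lia.
Qed.

(** Avoiding every finite [F] means having infinitely many common neighbours. *)
Definition linked (V : eqType) (R : rel V) (x y : V) : Prop :=
  forall F : seq V, exists v, [/\ v \notin F, R x v & R v y].

Lemma distinct_choices (V : eqType) (P : nat -> V -> Prop) (X : seq V) (n : nat) :
  (forall i (F : seq V), i < n -> exists2 v, v \notin F & P i v) ->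
  exists s : seq V, [/\ size s = n, uniq s, {in s, forall v, v \notin X} &
    forall x0 i, i < n -> P i (nth x0 s i)].
Proof.
elim: n => [|n IH] PX; first by exists [::].
have [i F /ltnW/PX //|s [sn us sX sP]] := IH.
have [v] := PX n (X ++ s) (leqnn _); rewrite mem_cat => /norP[vX vs] Pv.
exists (rcons s v); split.
- by rewrite size_rcons sn.
- by rewrite rcons_uniq vs.
- by move=> w; rewrite mem_rcons inE => /predU1P[->|/sX].
- move=> x0 i; rewrite ltnS leq_eqVlt nth_rcons sn => /predU1P[->|lt].
    by rewrite ltnn eqxx.
  by rewrite lt; apply: sP.
Qed.

(** The cycle alternates between h = l/2 terms of [g] and distinct common neighbours of cyclically
    consecutive ones, chosen greedily outside these terms. *)
Lemma linked_cycle (V : eqType) (R : rel V) (g : nat -> V) (l : nat) :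
  symmetric R -> injective g -> (forall i j, i < j -> linked R (g i) (g j)) ->
  4 <= l -> ~~ odd l -> hcopy (cycle_graph l) R.
Proof.
move=> Rs g_inj gP l4 evl; pose h := l./2.
have lh : l = h.*2 by have := odd_double_half l; rewrite (negPf evl).
pose nx i := if i.+1 == h then 0 else i.+1.
have link i : i < h -> linked R (g i) (g (nx i)).
  rewrite /nx; case: eqP => [ih _ F|_ _]; last exact: gP.
  have [|v [vF v1 v2]] := gP 0 i _ F; first lia.
  by exists v; split; rewrite // Rs.
have [i F /link/(_ F)[v [vF v1 v2]]|s [sh us sX sP]] :=
    @distinct_choices V (fun i v => R (g i) v /\ R v (g (nx i))) (mkseq g h) h.
  by exists v.
pose x0 := g 0; pose p i := if odd i then nth x0 s i./2 else g i./2.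
have half_lt i : i < l -> i./2 < h by lia.
have mixed a b : a < h -> b < h -> nth x0 s a <> g b.
  move=> ah bh e; have /negP := sX _ (mem_nth x0 (leq_trans ah (eq_leq (esym sh)))).
  by apply; rewrite e map_f // mem_iota.
apply: (hcopy_cycle (p := p)) => // [i j il jl|i il|].
- rewrite /p; case: ifP => oi; case: ifP => oj.
  + by move/eqP; rewrite nth_uniq ?sh ?half_lt // => /eqP; lia.
  + by move/mixed; case; apply: half_lt.
  + by move/esym/mixed; case; apply: half_lt.
  + by move/g_inj; lia.
- rewrite /p /=; case: ifP => oi /=.
    have [] := sP x0 i./2 (half_lt _ (ltnW il)).
    by rewrite /nx; case: eqP => [|_ _]; [lia|rewrite uphalf_half oi].
  have [+ _] := sP x0 i./2 (half_lt _ (ltnW il)).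
  by rewrite uphalf_half oi.
- rewrite /p; have -> : odd l.-1 by lia.
  have -> : l.-1./2 = h.-1 by lia.
  have [|_] := sP x0 h.-1; first lia.
  by rewrite /nx ifT //; lia.
Qed.

(** * Shift graphs and their odd girth *)

Definition shift (m : nat) : rel (seq nat) := fun x y =>
  [&& size x == m, sorted ltn (rcons x (last 0 y)) & y == behead (rcons x (last 0 y))].

Lemma shiftP m x y : shift m.+1 x y -> exists a s b,
  [/\ x = a :: s, y = rcons s b, size s = m & path ltn a (rcons s b)].
Proof.
case/and3P; case: x => // a s /eqP[sm] ss /eqP yE.
by exists a, s, (last 0 y).
Qed.

(** A step drops the least entry and appends one above all others. The count falls by one if the
    threshold [e] separates these two; otherwise all entries lie on one side of [e]. *)
Lemma shift_count m e x y : shift m.+1 x y ->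
  [\/ count (leq^~ e) x = (count (leq^~ e) y).+1,
      e < head 0 x /\ e < head 0 y |
      count (leq^~ e) x = m.+1 /\ count (leq^~ e) y = m.+1].
Proof.
case/shiftP=> a [s [b [-> -> sm ss]]]; rewrite -cats1 count_cat /=.
have [be|eb] := leqP b e; last first.
  have [ae|ea] := leqP a e; first by constructor 1; lia.
  constructor 2; split=> //; move: ss; case: s {sm} => //= c s /andP[ac _].
  exact: ltn_trans ea ac.
have all_le : {in a :: s, forall c, c <= e}.
  move=> c cs; apply: leq_trans be; apply: ltnW.
  have : sorted ltn (rcons (a :: s) b) by [].
  rewrite -cats1 (sorted_pairwise ltn_trans) pairwise_cat => /andP[/allrelP h _].
  by apply: h; rewrite ?mem_head.
constructor 3; have /eqP -> : count (leq^~ e) s == size s.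
  by rewrite -all_count; apply/allP => c cs; apply: all_le; rewrite inE cs orbT.
by rewrite (all_le a) ?mem_head //; lia.
Qed.

(* The number of entries at most [e] walks on the path with vertices 0, ..., m
   and a loop at both ends; a walk of odd length uses one of the loops.  Taking
   for [e] the largest first entry of the lower end of an edge rules out the
   loop at 0, while the value 0 is attained, so the walk covers the whole path
   twice. *)
Lemma shift_odd_walk (m n : nat) (x : nat -> seq nat) : odd n ->
  (forall i, x (i + n) = x i) ->
  (forall i, shift m.+1 (x i) (x i.+1) || shift m.+1 (x i.+1) (x i)) ->
  2 * m.+1 < n.
Proof.
move=> on xn xs.
pose hd i := head 0 (x i).
pose lo i := minn (hd i) (hd i.+1).
have n0 : 0 < n by case: n on {xn}.
pose e := lo [arg max_(i > Ordinal n0) lo i].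
have modx i : x (i %% n) = x i.
  rewrite [in RHS](divn_eq i n) addnC; elim: (i %/ n) => [|k IH]; first by rewrite addn0.
  by rewrite mulSnr addnA xn.
have lo_e i : lo i <= e.
  rewrite /e; case: arg_maxnP => // j _ /(_ (Ordinal (ltn_pmod i n0)) isT) /=.
  by rewrite {1}/lo /hd modx -(modx (_ %% _).+1) -addn1 modnDml addn1 modx.
have [i0 i0e] : exists i0, lo i0 = e by eexists; reflexivity.
pose phi i := count (leq^~ e) (x i).
have phin i : phi (i + n) = phi i by rewrite /phi xn.
have step i : [\/ phi i = (phi i.+1).+1, phi i.+1 = (phi i).+1 | phi i = m.+1 /\ phi i.+1 = m.+1].
  have := lo_e i; rewrite /lo /hd geq_min.
  by case/orP: (xs i) => /(@shift_count m e)[]; rewrite -/(phi i) -/(phi i.+1);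
    [constructor 1 | case; lia | constructor 3 | constructor 2 | case; lia | case; constructor 3].
have lip i k : phi (i + k) <= phi i + k /\ phi i <= phi (i + k) + k.
  elim: k => [|k]; first by rewrite addn0; lia.
  by rewrite addnS; case: (step (i + k)); lia.
have [p phip] : exists p, phi p = 0.
  have head0 y : sorted ltn y -> e < head 0 y -> count (leq^~ e) y = 0.
    case: y => // a s ss ea; apply/eqP; rewrite -leqn0 leqNgt -has_count; apply/hasPn => c.
    rewrite inE => /predU1P[->|cs]; rewrite -ltnNge //; apply: ltn_trans ea _.
    by move: ss; rewrite /= (path_sortedE ltn_trans) => /andP[/allP/(_ c cs)].
  have srt a s b : path ltn a (rcons s b) -> sorted ltn (a :: s) /\ sorted ltn (rcons s b).
    move=> ss; split; last exact: path_sorted ss.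
    by move: ss; rewrite -cats1 cat_path => /andP[].
  have hdlt a s b : path ltn a (rcons s b) -> a < head 0 (rcons s b).
    by case: s => [|c s] /= /andP[].
  case/orP: (xs i0) => /shiftP[a [s [b [xa xb _ ss]]]]; have [s1 s2] := srt _ _ _ ss;
    have ah := hdlt _ _ _ ss; have ea : e = a by [move: i0e; rewrite /lo /hd xa xb /=; lia].
    by exists i0.+1; rewrite /phi xb; apply: head0; rewrite // ea.
  by exists i0; rewrite /phi xb; apply: head0; rewrite // ea.
have [j [j1 j2]] : exists j, phi j = m.+1 /\ phi j.+1 = m.+1.
  apply: contrapT => /forallNP noj.
  have par i : odd (phi i + i) = odd (phi 0).
    elim: i => [|i <-]; first by rewrite addn0.
    by case: (step i) => [->|->|/noj//]; lia.
  by have := par n; rewrite -[n in phi n]add0n phin; lia.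
(* From [j.+1] the walk descends to 0 in [k] steps and is back at the top after [n - k.+1] more;
   both parts take at least [m.+1] steps. The multiple of [n] keeps the subtraction exact. *)
pose k := (p + (j.+1 * n - j.+1)) %% n.
have jk : phi (j.+1 + k) = 0.
  rewrite -phip /phi -[x (_ + k)]modx -[x p]modx; congr (count _ (x _)).
  by rewrite /k modnDmr addnCA subnKC ?leq_pmulr // addnC modnMDl.
have kn : k < n by apply: ltn_pmod.
have [_] := lip j.+1 k; have [+ _] := lip (j.+1 + k) (n - k.+1).
have -> : j.+1 + k + (n - k.+1) = j + n by lia.
by rewrite phin j1 j2 jk; lia.
Qed.

(** The map [h] sends an odd cycle to an odd closed walk of the shift graph, which is longer than
    2m. *)
Lemma shift_no_odd_cycle (V : Type) (E : rel V) (h : V -> seq nat) (m n : nat) :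
  (forall x y, E x y -> shift m (h x) (h y)) -> odd n -> 3 <= n <= 2 * m ->
  ~ hcopy (cycle_graph n) [rel x y | E x y || E y x].
Proof.
case: m => [|m] Eh on /andP[n3 nm]; first by lia.
case/(cycle_walk n3) => x [xn xE].
have := @shift_odd_walk m n (h \o x) on; rewrite ltnNge nm; case/(_ _ _)/negP => // i /=.
  by rewrite xn.
by case/orP: (xE i) => /Eh -> //; rewrite orbT.
Qed.

(** The vertex [z] closes a path with [p] edges to a cycle of length p + 2. *)
Lemma hcopy_cone_cycle (V : eqType) (R : rel V) (x : nat -> V) (z : V) (p : nat) :
  symmetric R -> (forall i j, i <= p -> j <= p -> x i = x j -> i = j) ->
  (forall i, i <= p -> x i != z) -> (forall i, i < p -> R (x i) (x i.+1)) ->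
  R z (x 0) -> R z (x p) -> hcopy (cycle_graph p.+2) R.
Proof.
move=> Rs x_inj xz xR z0 zp.
apply: (hcopy_cycle (p := fun i => if i is j.+1 then x j else z)) => //=.
- move=> [|i] [|j] ip jp //.
  + by move/esym/eqP; rewrite (negPf (xz _ _)).
  + by move/eqP; rewrite (negPf (xz _ _)).
  + by move/x_inj => ->.
- by case=> [|i] ip //; apply: xR.
- by rewrite Rs.
Qed.

Lemma sorted_catE s t : sorted ltn (s ++ t) = [&& allrel ltn s t, sorted ltn s & sorted ltn t].
Proof. by rewrite !(sorted_pairwise ltn_trans) pairwise_cat. Qed.

Lemma sorted_cat_bound s t b : sorted ltn s -> sorted ltn t ->
  {in s, forall x, x < b} -> {in t, forall x, b <= x} -> sorted ltn (s ++ t).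
Proof.
move=> ss st sb tb; rewrite sorted_catE ss st !andbT; apply/allrelP => x y /sb xb /tb.
exact: leq_trans.
Qed.

Lemma sorted_mkseq (w : nat -> nat) n : {homo w : x y / x < y} -> sorted ltn (mkseq w n).
Proof. by move=> w_homo; apply: sorted_ltn_map; rewrite ?iota_ltn_sorted. Qed.

Lemma mem_mkseq_lt (w : nat -> nat) n b : {homo w : x y / x < y} -> w n.-1 < b ->
  {in mkseq w n, forall x, x < b}.
Proof.
move=> w_homo wb _ /mapP[i + ->]; rewrite mem_iota => /andP[_ ilt]; apply: leq_ltn_trans wb.
by apply: (ltnW_homo w_homo); lia.
Qed.

Definition window (n : nat) (w : nat -> nat) (t : nat) : seq nat := mkseq (fun i => w (t + i)) n.

Lemma size_window n w t : size (window n w t) = n. Proof. exact: size_mkseq. Qed.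

Lemma rcons_window n w t : 0 < n ->
  rcons (window n w t) (last 0 (window n w t.+1)) = window n.+1 w t.
Proof.
case: n => // n _; rewrite /window [X in last 0 X]mkseqS last_rcons [RHS]mkseqS.
by rewrite addSnnS.
Qed.

Lemma behead_window n w t : behead (window n.+1 w t) = window n w t.+1.
Proof.
rewrite /window /mkseq /= (iotaDl 1 0) -map_comp; apply: eq_map => i /=.
by congr (w _); lia.
Qed.

Lemma sorted_window n w t : {homo w : x y / x < y} -> sorted ltn (window n w t).
Proof. by move=> w_homo; apply: sorted_mkseq => i j ij; apply: w_homo; rewrite ltn_add2l. Qed.

Lemma shift_window n w t : 0 < n -> {homo w : x y / x < y} ->
  shift n (window n w t) (window n w t.+1).
Proof.
move=> n0 w_homo; rewrite /shift rcons_window // behead_window size_window !eqxx.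
by rewrite sorted_window.
Qed.

Lemma window_inj n w : 0 < n -> {homo w : x y / x < y} -> injective (window n w).
Proof.
case: n => // n _ /homo_ltn_inj w_inj i j /(congr1 (head 0)).
by rewrite /window /= !addn0 => /w_inj.
Qed.

(** The first entry grows strictly; for [n = 0] the empty sequence is its own shift. *)
Lemma shift_irrefl n x : 0 < n -> shift n x x = false.
Proof.
case: n => // n _; apply/negP => /shiftP[a [s [b [xE1 xE2 _ ss]]]].
have : head 0 x = a by rewrite xE1.
by rewrite xE2; case: s ss {xE1 xE2} => [|c s] /= /andP[+ _] e; rewrite e ltnn.
Qed.

Lemma shift_map n g x y : {homo g : x y / x < y} -> 0 < n -> shift n x y ->
  shift n (map g x) (map g y).
Proof.
move=> g_homo; case: n => // n _ /and3P[/eqP sx ss /eqP yE].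
have lst : last 0 (map g y) = g (last 0 y).
  by rewrite yE; case: (x) sx => //= a s _; rewrite !map_rcons !last_rcons.
rewrite /shift size_map sx eqxx lst -map_rcons sorted_ltn_map //=.
by rewrite behead_map -yE.
Qed.

Lemma last_shift n g x y : shift n.+1 x y -> last 0 (map g y) = g (last 0 y).
Proof. by case/shiftP => a [s [b [_ -> _ _]]]; rewrite map_rcons !last_rcons. Qed.

(** * Pairs of sequences with two types of shift steps *)

Notation dseq := (seq nat * seq nat)%type.

Definition dmap (g : nat -> nat) (v : dseq) : dseq := (map g v.1, map g v.2).

Lemma dmap_inj g : injective g -> injective (dmap g).
Proof. by move=> g_inj [a u] [b v] [] /(inj_map g_inj) -> /(inj_map g_inj) ->. Qed.

Section TwoShifts.
Variables m r : nat.

(* The entries of the first coordinates are below those of the second ones, so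
   that the order type of a step is fixed and Ramsey's theorem applies to it. *)
Definition low_step : rel dseq := fun v w =>
  [&& size v.2 == r, size w.2 == r, shift m v.1 w.1 &
      sorted ltn (rcons v.1 (last 0 w.1) ++ v.2 ++ w.2)].

Definition high_step : rel dseq := fun v w =>
  [&& size v.1 == m, size w.1 == m, shift r v.2 w.2 &
      sorted ltn (v.1 ++ w.1 ++ rcons v.2 (last 0 w.2))].

Lemma low_step_map g v w : {homo g : x y / x < y} -> 0 < m -> low_step v w ->
  low_step (dmap g v) (dmap g w).
Proof.
move=> g_homo m0 /and4P[s1 s2 sh ss]; rewrite /low_step !size_map s1 s2 shift_map //=.
case: m m0 sh => // m' _ sh; rewrite (last_shift _ sh).
by rewrite -map_rcons -!map_cat sorted_ltn_map.
Qed.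

Lemma high_step_map g v w : {homo g : x y / x < y} -> 0 < r -> high_step v w ->
  high_step (dmap g v) (dmap g w).
Proof.
move=> g_homo m0 /and4P[s1 s2 sh ss]; rewrite /high_step !size_map s1 s2 shift_map //=.
case: r m0 sh => // m' _ sh; rewrite (last_shift _ sh).
by rewrite -map_rcons -!map_cat sorted_ltn_map.
Qed.

(** The fixed order type codes a step by one increasing sequence of m + 1 + 2r entries, from which
    [dec] recovers both ends. *)
Lemma homogeneous_low (R : rel dseq) : 0 < m -> exists g : nat -> nat,
  {homo g : x y / x < y} /\
  ((forall v w, low_step v w -> R (dmap g v) (dmap g w)) \/
   (forall v w, low_step v w -> ~ R (dmap g v) (dmap g w))).
Proof.
move=> m0; pose dec (s : seq nat) : dseq * dseq :=
  ((take m s, take r (drop m.+1 s)), (behead (take m.+1 s), drop (m.+1 + r) s)).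
have decP g v w : low_step v w -> exists s, [/\ sorted ltn s, size s = m.+1 + r + r &
    dec (map g s) = (dmap g v, dmap g w)].
  case/and4P=> /eqP s1 /eqP s2 /and3P[/eqP sm _ /eqP wE] ss; set a := last _ _ in ss wE.
  exists (rcons v.1 a ++ v.2 ++ w.2); split=> //.
    by rewrite !size_cat size_rcons sm s1 s2 addnA.
  have sma : size (map g (rcons v.1 a)) = m.+1 by rewrite size_map size_rcons sm.
  rewrite /dec !map_cat [take m.+1 _]take_size_cat // [drop m.+1 _]drop_size_cat //.
  rewrite [take r _]take_size_cat ?size_map // catA drop_size_cat ?size_cat ?sma ?size_map ?s1 //.
  rewrite -catA map_rcons -cats1 -catA take_size_cat ?size_map //.
  by rewrite /dmap cats1 -map_rcons behead_map -wE.
have [g [g_homo gP]] := ramsey (m.+1 + r + r) (fun s => R (dec s).1 (dec s).2).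
exists g; split=> //; case: gP => gP; [left|right] => v w /(decP g)[s [ss sz de]];
  by have := gP s ss sz; rewrite de.
Qed.

Lemma homogeneous_high (R : rel dseq) : 0 < r -> exists g : nat -> nat,
  {homo g : x y / x < y} /\
  ((forall v w, high_step v w -> R (dmap g v) (dmap g w)) \/
   (forall v w, high_step v w -> ~ R (dmap g v) (dmap g w))).
Proof.
move=> r0; pose dec (s : seq nat) : dseq * dseq :=
  ((take m s, take r (drop (m + m) s)), (take m (drop m s), behead (drop (m + m) s))).
have decP g v w : high_step v w -> exists s, [/\ sorted ltn s, size s = m + m + r.+1 &
    dec (map g s) = (dmap g v, dmap g w)].
  case/and4P=> /eqP s1 /eqP s2 /and3P[/eqP sm _ /eqP wE] ss; set a := last _ _ in ss wE.
  exists (v.1 ++ w.1 ++ rcons v.2 a); split=> //.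
    by rewrite !size_cat size_rcons sm s1 s2 addnA.
  rewrite /dec !map_cat [take m (map g _ ++ _)]take_size_cat ?size_map //.
  rewrite [drop m _]drop_size_cat ?size_map // [take m _]take_size_cat ?size_map //.
  rewrite catA drop_size_cat ?size_cat ?size_map ?s1 ?s2 //.
  rewrite map_rcons -cats1 take_size_cat ?size_map //.
  by rewrite /dmap cats1 -map_rcons behead_map -wE.
have [g [g_homo gP]] := ramsey (m + m + r.+1) (fun s => R (dec s).1 (dec s).2).
exists g; split=> //; case: gP => gP; [left|right] => v w /(decP g)[s [ss sz de]];
  by have := gP s ss sz; rewrite de.
Qed.

(** Vertices of paths: one coordinate is a moving window of [w], the other an interval placed at
    [c t]. *)
Definition low_vertex (w c : nat -> nat) (t : nat) : dseq := (window m w t, iota (c t) r).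
Definition high_vertex (w c : nat -> nat) (t : nat) : dseq := (iota (c t) m, window r w t).

Lemma low_vertex_step w c t : 0 < m -> {homo w : x y / x < y} ->
  w (t + m) < c t -> c t + r <= c t.+1 -> low_step (low_vertex w c t) (low_vertex w c t.+1).
Proof.
move=> m0 w_homo wc cc; rewrite /low_step /= !size_iota !eqxx shift_window //= rcons_window //.
apply: (@sorted_cat_bound _ _ (c t)); first exact: sorted_window.
- apply: (@sorted_cat_bound _ _ (c t + r)); rewrite ?iota_ltn_sorted // => x; rewrite mem_iota; lia.
- by apply: mem_mkseq_lt => [i j ij|]; [apply: w_homo; rewrite ltn_add2l|].
- by move=> x; rewrite mem_cat !mem_iota; lia.
Qed.

Lemma high_vertex_step w c t : 0 < r -> {homo w : x y / x < y} ->
  c t + m <= c t.+1 -> c t.+1 + m <= w t -> high_step (high_vertex w c t) (high_vertex w c t.+1).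
Proof.
move=> r0 w_homo cc wc; rewrite /high_step /= !size_iota !eqxx shift_window //= rcons_window //.
have wt : {in window r.+1 w t, forall x, w t <= x}.
  by move=> _ /mapP[i _ ->]; apply: (ltnW_homo w_homo); rewrite leq_addr.
apply: (@sorted_cat_bound _ _ (c t + m)); rewrite ?iota_ltn_sorted //.
- apply: (@sorted_cat_bound _ _ (w t)); rewrite ?iota_ltn_sorted ?sorted_window //.
  by move=> x; rewrite mem_iota; lia.
- by move=> x; rewrite mem_iota; lia.
- by move=> x; rewrite mem_cat mem_iota => /orP[|/wt]; lia.
Qed.

Lemma low_vertex_inj w c : 0 < m -> {homo w : x y / x < y} -> injective (low_vertex w c).
Proof. by move=> m0 w_homo i j [] /(window_inj m0 w_homo). Qed.

Lemma high_vertex_inj w c : 0 < r -> {homo w : x y / x < y} -> injective (high_vertex w c).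
Proof. by move=> r0 w_homo i j [_] /(window_inj r0 w_homo). Qed.

Section Cycles.
Variables (V : eqType) (R : rel V) (e : dseq -> V).
Hypotheses (Rs : symmetric R) (e_inj : injective e).

(** Far apart vertices: [G] leaves room between blocks for the intervals used along a path, and [N]
    separates the first coordinates from the second ones. *)
Definition block (G N i : nat) : dseq := (iota (i * G) m, iota (N + i * G) r).

(** It runs through [p] numbers from the start of block [i] and goes on at block [j], so windows of
    length at most [p] at 0 and at [p] are the two blocks. *)
Let jump (G p i j t : nat) := if t < p then i * G + t else j * G + (t - p).

Let jump_homo G p i j : p <= G -> i < j -> {homo jump G p i j : x y / x < y}.
Proof.
move=> pG ij x y xy; rewrite /jump; have := leq_mul2r G i.+1 j; rewrite ij orbT mulSn.
by do 2 case: ifP; lia.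
Qed.

(** The first coordinate is the window of [jump] at [t]; the second one moves through disjoint
    intervals behind block [i] and ends on block [j]. *)
Lemma low_path (G N p i j : nat) : 0 < m <= p -> p.+1 * r.+1 + m <= G -> j.+2 * G <= N -> i < j ->
  exists x : nat -> dseq, [/\ x 0 = block G N i, x p = block G N j, injective x &
    forall t, t < p -> low_step (x t) (x t.+1)].
Proof.
case/andP=> m0 mp pG GN ij.
have ijG : i * G + G <= j * G by have := leq_mul2r G i.+1 j; rewrite ij orbT mulSn addnC.
have pp : p.+1 <= p.+1 * r.+1 by rewrite leq_pmulr.
pose w := jump G p i j; pose c t := if t < p then N + i * G + t * r else N + j * G.
have w_homo : {homo w : x y / x < y} by apply: jump_homo => //; lia.
exists (low_vertex w c); split.
- rewrite /low_vertex /c (leq_trans m0 mp) mul0n addn0; congr (_, _).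
  rewrite /window /mkseq -[in RHS](addn0 (i * G)) iotaDl.
  apply/eq_in_map => s; rewrite mem_iota => sm.
  by rewrite /w /jump add0n ifT //; lia.
- rewrite /low_vertex /c ltnn; congr (_, _).
  rewrite /window /mkseq -[in RHS](addn0 (j * G)) iotaDl.
  apply/eq_in_map => s; rewrite mem_iota => sm.
  by rewrite /w /jump ifF; lia.
- exact: low_vertex_inj.
- move=> t tp; have wlt : w (t + m) < N.
    by move: GN; rewrite /w /jump !mulSn; case: ifP; lia.
  have tr : t.+1 * r <= p.+1 * r.+1 by rewrite leq_mul; lia.
  rewrite mulSn in tr.
  apply: low_vertex_step => //; rewrite /c tp; first lia.
  by case: ifP => _; rewrite ?mulSn; lia.
Qed.

Lemma high_path (G N p i j : nat) : 0 < r <= p -> p.+1 * m.+1 + r <= G -> j.+2 * G <= N -> i < j ->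
  exists x : nat -> dseq, [/\ x 0 = block G N i, x p = block G N j, injective x &
    forall t, t < p -> high_step (x t) (x t.+1)].
Proof.
case/andP=> r0 rp pG GN ij.
have ijG : i * G + G <= j * G by have := leq_mul2r G i.+1 j; rewrite ij orbT mulSn addnC.
have pp : p.+1 <= p.+1 * m.+1 by rewrite leq_pmulr.
pose w t := N + jump G p i j t; pose c t := if t < p then i * G + t * m else j * G.
have w_homo : {homo w : x y / x < y}.
  by move=> x y xy; rewrite ltn_add2l; apply: jump_homo => //; lia.
exists (high_vertex w c); split.
- rewrite /high_vertex /c (leq_trans r0 rp) mul0n addn0; congr (_, _).
  rewrite /window /mkseq -[in RHS](addn0 (N + i * G)) iotaDl.
  apply/eq_in_map => s; rewrite mem_iota => sm.
  by rewrite /w /jump add0n ifT ?addnA //; lia.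
- rewrite /high_vertex /c ltnn; congr (_, _).
  rewrite /window /mkseq -[in RHS](addn0 (N + j * G)) iotaDl.
  apply/eq_in_map => s; rewrite mem_iota => sm.
  by rewrite /w /jump ifF; lia.
- exact: high_vertex_inj.
- move=> t tp; have tm : t.+1 * m <= p.+1 * m.+1 by rewrite leq_mul; lia.
  have t2 : t.+2 * m <= p.+1 * m.+1 by rewrite leq_mul; lia.
  rewrite !mulSn in GN tm t2.
  apply: high_vertex_step => //; first by rewrite /c tp; case: ifP => _; rewrite ?mulSn; lia.
  by rewrite /w /jump tp /c; case: ifP => _; rewrite ?mulSn; lia.
Qed.

(** The cycle consists of two paths of low steps with common ends, of lengths p = n - m and m. *)
Lemma low_step_cycle (n : nat) : 2 <= m -> 2 * m < n ->
  (forall v w, low_step v w -> R (e v) (e w)) -> hcopy (cycle_graph n) R.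
Proof.
move=> m2 mn sR; have [p pE] : exists p, p = n - m by exists (n - m).
have [N NE] : exists N, N = 2 * n by exists (2 * n).
pose c t := N + t * r.
(* Skipping from [m - 1] straight to [p], the windows of [w'] reach the window at [p] in only [m]
   steps. *)
pose w' s := if s < m then s else s - m + p.
pose c' t := N + (if t < m then t else p) * r.
have w'_homo : {homo w' : x y / x < y}.
  by move=> x y xy; rewrite /w'; do 2 case: ifP; lia.
pose P := low_vertex (fun t => t) c; pose Q := low_vertex w' c'.
have V0 : Q 0 = P 0.
  rewrite /Q /P /low_vertex /c' /c (leq_trans _ m2) //; congr (_, _).
  by apply/eq_in_map => s; rewrite mem_iota /w' => sm; rewrite ifT //; lia.
have Vm : Q m = P p.
  rewrite /Q /P /low_vertex /c' /c ltnn; congr (_, _).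
  by apply/eq_in_map => s; rewrite mem_iota /w' => sm; rewrite ifF; lia.
have stepV t : t <= p -> low_step (P t) (P t.+1).
  move=> tp; apply: low_vertex_step; rewrite /c ?mulSn //; nia.
have stepV' t : t < m -> low_step (Q t) (Q t.+1).
  move=> tm; apply: low_vertex_step; rewrite /c' //; first lia.
    by rewrite tm /w'; case: ifP; nia.
  rewrite tm -addnA -mulSnr leq_add2l leq_mul2r; apply/orP; right.
  by case: ifP => //; lia.
(* An inner vertex of the short path contains the gap before [p], as p > m, whereas the long path
   has windows of consecutive numbers. *)
have VV' i t : 0 < t < m -> P i <> Q t.
  move=> /andP[t0 tm] [] e1 _.
  have := congr1 (head 0) e1; have := congr1 (last 0) e1.
  have wl f t0' : last 0 (window m f t0') = f (t0' + m.-1).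
    by rewrite /window -(prednK (leq_trans _ m2)) // mkseqS last_rcons.
  have wh f t0' : head 0 (window m f t0') = f t0'.
    by rewrite /window -(prednK (leq_trans _ m2)) //= addn0.
  by rewrite !wl !wh /w' tm ifF; lia.
have V_inj : injective P by apply: low_vertex_inj => //; lia.
have Q_inj : injective Q by apply: low_vertex_inj => //; lia.
apply: (hcopy_cycle (p := fun i => e (if i <= p then P i else Q (n - i)))) => //.
- move=> i j il jl /e_inj; case: leqP => ip; case: leqP => jp.
  + exact: V_inj.
  + by move/VV'; case; lia.
  + by move/esym/VV'; case; lia.
  + by move/Q_inj; lia.
- move=> i il; case: (ltngtP i p) => ip.
  + by apply/sR/stepV; lia.
  + have -> : n - i = (n - i.+1).+1 by lia.
    by rewrite Rs; apply/sR/stepV'; lia.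
  + have qm : m.-1 < m by lia.
    have := stepV' _ qm; rewrite prednK ?(leq_trans _ m2) // Vm => /sR.
    by rewrite Rs ip; congr (R (e _) (e (Q _))); lia.
- rewrite leq0n -V0 ifF; last lia.
  have q1 : 0 < m by lia.
  have /sR := stepV' _ q1; rewrite Rs; congr (R (e (Q _)) _); lia.
Qed.

(** A path of [n - 2] low steps from [P 0] to [P p] is closed by a vertex [X], with a high step from
    [P 0] to [X] and a low step from [X] to [P p]. *)
Lemma both_steps_cycle (n : nat) : 0 < m -> 0 < r -> m.+2 <= n ->
  (forall v w, low_step v w -> R (e v) (e w)) ->
  (forall v w, high_step v w -> R (e v) (e w)) -> hcopy (cycle_graph n) R.
Proof.
move=> m0 r0 mn lR hR; have [p pE] : exists p, n = p.+2 by exists (n - 2); lia.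
have [N NE] : exists N, N = 4 * n by exists (4 * n).
pose w t := 2 * t.
pose c t := if t is 0 then N else N + t * r.+1.
(* The first coordinate shifts to that of [P p], the second is the shift of that of [P 0]. The odd
   entry 2p - 1 keeps [X] off the path, where first coordinates have even entries, and exceeds the
   first coordinate of [P 0] because p >= m. *)
pose X : dseq := (p.*2.-1 :: window m.-1 w p, iota N.+1 r).
have w_homo : {homo w : x y / x < y} by move=> x y; rewrite /w; lia.
pose P := low_vertex w c.
have V_inj : injective P by apply: low_vertex_inj.
have stepV t : t < p -> low_step (P t) (P t.+1).
  move=> tp; apply: low_vertex_step => //; rewrite /c; case: t tp => [|t] tp; rewrite /w; nia.
have hs t : head 0 (P t).1 = 2 * t.
  by rewrite /P /low_vertex /window /= -(prednK m0) /= addn0.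
have lastV t : last 0 (P t).1 = 2 * (t + m.-1).
  by rewrite /P /low_vertex /window /= -[in mkseq _ m](prednK m0) mkseqS last_rcons.
have sX : sorted ltn (rcons X.1 (2 * (p + m.-1))).
  have -> : rcons X.1 (2 * (p + m.-1)) = p.*2.-1 :: window m w p.
    by rewrite /= /window -[in RHS](prednK m0) [in RHS]mkseqS.
  rewrite /= (path_sortedE ltn_trans) sorted_window // andbT.
  by apply/allP => _ /mapP[i _ ->]; rewrite /w; lia.
have cp : N.+1 + r <= c p.
  have p0 : 0 < p by lia.
  by rewrite /c; case: (p) p0 => // p' _; rewrite mulSn; lia.
have XV : low_step X (P p).
  apply/and4P; split; rewrite ?size_iota //.
    rewrite /shift lastV sX /= size_window prednK // eqxx /=.
    by apply/eqP; rewrite /window -[in LHS](prednK m0) [in LHS]mkseqS.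
  rewrite lastV; apply: (@sorted_cat_bound _ _ N.+1) => //.
  - apply: (@sorted_cat_bound _ _ (N.+1 + r)); rewrite ?iota_ltn_sorted // => x;
      rewrite mem_iota; lia.
  - move=> x; rewrite mem_rcons inE => /predU1P[->|]; first by lia.
    rewrite inE => /predU1P[->|/mapP[i + ->]]; first by lia.
    by rewrite mem_iota /w; lia.
  - move=> x; rewrite mem_cat !mem_iota => /orP[]; lia.
have VX : high_step (P 0) X.
  have lN : last 0 (iota N.+1 r) = N + r.
    by rewrite -nth_last size_iota nth_iota; lia.
  have rN : rcons (iota N r) (N + r) = iota N r.+1.
    by rewrite -addn1 iotaD cats1.
  apply/and4P; split; rewrite ?size_window //= ?size_window ?prednK //.
    by rewrite /shift lN /c rN size_iota eqxx iota_ltn_sorted /=.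
  rewrite lN /c rN; apply: (@sorted_cat_bound _ _ p.*2.-1).
  - exact: sorted_window.
  - change (sorted ltn (X.1 ++ iota N r.+1)).
    apply: (@sorted_cat_bound _ _ N); rewrite ?iota_ltn_sorted //.
    + by move: sX; rewrite -cats1 sorted_catE => /and3P[].
    + move=> x; rewrite inE => /predU1P[->|/mapP[i + ->]]; first by lia.
      by rewrite mem_iota /w; lia.
    + by move=> x; rewrite mem_iota => /andP[].
  - by move=> _ /mapP[i + ->]; rewrite mem_iota /w; lia.
  - move=> x; rewrite inE mem_cat => /predU1P[->//|/orP[/mapP[i _ ->]|]].
      by rewrite /w; lia.
    by rewrite mem_iota; lia.
rewrite pE.
apply: (hcopy_cone_cycle (x := fun t => e (P t)) (z := e X)) => //.
- by move=> i j _ _ /e_inj/V_inj.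
- move=> i ip; apply/eqP => /e_inj/(congr1 (fun v => head 0 v.1)).
  by rewrite hs /=; lia.
- by move=> i ip; apply/lR/stepV.
- by rewrite Rs; apply: hR.
- exact: lR.
Qed.

End Cycles.
End TwoShifts.

(** * Cycles against cycles *)

Definition realizable (d : nat) (H1 H2 : sgraph) : Prop :=
  exists (V : countType) (E : rel V),
    [/\ irreflexive E, ~ arrows E H1 H2 & arrows (fresh_rel d E) H1 H2].

Lemma realizableC d H1 H2 : realizable d H1 H2 -> realizable d H2 H1.
Proof.
by case=> V [E [irr nE aE]]; exists V, E; split=> //; [move/arrowsC|apply/arrowsC].
Qed.

Lemma hcopy_bipartite_cycle (V : eqType) (R : rel V) (a b : nat -> V) (l : nat) :
  symmetric R -> (forall i j, i < l -> j < l -> a i = a j -> i = j) ->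
  (forall i j, i < l -> j < l -> b i = b j -> i = j) ->
  (forall i j, i < l -> j < l -> a i != b j) -> (forall i j, i < l -> j < l -> R (a i) (b j)) ->
  4 <= l -> ~~ odd l -> hcopy (cycle_graph l) R.
Proof.
move=> Rs a_inj b_inj ab Rab l4 evl.
have half_lt i : i < l -> i./2 < l by lia.
apply: (hcopy_cycle (p := fun i => if odd i then b i./2 else a i./2)) => // [i j il jl|i il|].
- case: ifP => oi; case: ifP => oj.
  + by move/(b_inj _ _ (half_lt _ il) (half_lt _ jl)); lia.
  + by move/esym/eqP; rewrite (negPf (ab _ _ _ _)) ?half_lt.
  + by move/eqP; rewrite (negPf (ab _ _ _ _)) ?half_lt.
  + by move/(a_inj _ _ (half_lt _ il) (half_lt _ jl)); lia.
- rewrite /=; case: ifP => _ /=; last by apply: Rab; lia.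
  by rewrite Rs; apply: Rab; lia.
- have -> : odd l.-1 by lia.
  by rewrite Rs; apply: Rab; lia.
Qed.

Lemma not_linked (V : eqType) (R : rel V) (x y : V) : ~ linked R x y ->
  exists F : seq V, forall u, u \notin F -> ~ (R x u /\ R u y).
Proof.
case/existsNP=> F /forallNP noF; exists F => u uF [xu uy].
by apply: (noF u).
Qed.

Section FreshVertices.
Variables (V : countType) (E : rel V) (d : nat).
Local Notation U := (V + seq V * nat)%type.

Lemma fresh_avoid (A : seq V) (F : seq U) : exists n, inr (A, n) \notin F.
Proof.
suff [N NF] : exists N, forall n, N <= n -> inr (A, n) \notin F by exists N; apply: NF.
elim: F => [|u F [N NF]]; first by exists 0.
exists (maxn N (if u is inr p then p.2.+1 else 0)) => n; rewrite geq_max => /andP[/NF nF un].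
by rewrite inE negb_or nF andbT; apply/eqP => uE; rewrite -uE ltnn in un.
Qed.

Lemma fresh_cover (R B : rel U) (A : seq V) (n : nat) : symmetric R -> symmetric B ->
  (forall x y, fresh_rel d E x y -> R x y || B x y) -> size A <= d ->
  forall x, x \in A -> R (inr (A, n)) (inl x) || B (inr (A, n)) (inl x).
Proof. by move=> Rs Bs cov Ad x xA; rewrite Rs Bs; apply: cov; rewrite /= xA. Qed.

(* Any three terms of a suitable subsequence have a new common neighbour with at
   most one blue edge to them: otherwise infinitely many pairs are linked in blue. *)
Lemma two_red_edges (R B : rel U) (S : nat -> V) (l : nat) : symmetric R -> symmetric B ->
  (forall x y, fresh_rel d E x y -> R x y || B x y) -> 3 <= d -> injective S ->
  4 <= l -> ~~ odd l -> ~ hcopy (cycle_graph l) B ->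
  exists g : nat -> nat, {homo g : x y / x < y} /\
    forall (x : nat -> U), (forall i, x i = inl (S (g i))) ->
    forall i j k (F : seq U), i < j < k -> exists u, [/\ u \notin F, is_fresh u &
      [\/ R (x i) u /\ R u (x j), R (x j) u /\ R u (x k) | R (x i) u /\ R u (x k)]].
Proof.
move=> Rs Bs cov d3 S_inj l4 evl noB.
have [g [g_homo gP]] := ramsey 2 (fun s => linked B (inl (S (nth 0 s 0))) (inl (S (nth 0 s 1)))).
exists g; split=> // x xE i j k F /andP[ij jk].
have notlinked a b : a < b -> ~ linked B (x a) (x b).
  move=> ab; case: gP => [gl|/(_ [:: a; b])]; last by rewrite /= ab !xE => /(_ isT erefl).
  move=> _; apply: noB; apply: (linked_cycle (g := x)) => // [a' b'|a' b' ab'].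
    by rewrite !xE => -[] /S_inj/(homo_ltn_inj g_homo).
  by rewrite !xE; apply: (gl [:: a'; b']) => //=; rewrite ab'.
have [F1 h1] := not_linked (notlinked i j ij).
have [F2 h2] := not_linked (notlinked j k jk).
have [F3 h3] := not_linked (notlinked i k (ltn_trans ij jk)).
pose A := [:: S (g i); S (g j); S (g k)].
have [n] := fresh_avoid A (F ++ F1 ++ F2 ++ F3); rewrite !mem_cat !negb_or.
case/and4P=> nF n1 n2 n3; exists (inr (A, n)); split=> //.
have c a : S (g a) \in A -> R (inr (A, n)) (x a) || B (inr (A, n)) (x a).
  by rewrite xE => aA; apply: (fresh_cover n Rs Bs cov _ aA).
have := (h1 _ n1, h2 _ n2, h3 _ n3).
have := c i; have := c j; have := c k; rewrite !inE !eqxx ?orbT !(Rs (x _)) !(Bs (x _)).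
move=> /(_ isT)/orP[ck|ck] /(_ isT)/orP[cj|cj] /(_ isT)/orP[ci|ci] [[q1 q2] q3];
  by [constructor 1 | constructor 2 | constructor 3 | case: q1 | case: q2 | case: q3].
Qed.

End FreshVertices.

(** The edgeless graph serves as [E]. If neither color links infinitely many terms pairwise, some
    three terms have finitely many common red neighbours in pairs, but [two_red_edges] finds one
    outside any finite set. *)
Lemma even_even_cycles (k l : nat) : 4 <= k -> 4 <= l -> ~~ odd k -> ~~ odd l ->
  realizable 3 (cycle_graph k) (cycle_graph l).
Proof.
move=> k4 l4 evk evl; exists nat, (fun _ _ => false); split=> //.
  have no n : 3 <= n -> ~ hcopy (cycle_graph n) (fun _ _ : nat => false).
    by move=> n3 /(cycle_walk n3)[x [_ /(_ 0)]].
  by move/(_ (fun _ _ => false) (fun _ _ => false)) => []// /no; apply; apply: ltnW.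
move=> R B Rs Bs cov; apply: contrapT => /not_orP[noR noB].
have [g [g_homo gP]] := two_red_edges Rs Bs cov (leqnn 3) (@inj_id _) l4 evl noB.
pose x i : nat + seq nat * nat := inl (g i).
have {}gP := gP x (fun=> erefl).
have x_inj : injective x by move=> i j [] /(homo_ltn_inj g_homo).
have [h [h_homo [hl|hn]]] := ramsey 2 (fun s => linked R (x (nth 0 s 0)) (x (nth 0 s 1))).
  apply: noR; apply: (linked_cycle (g := x \o h)) => // [|i j ij].
    exact: inj_comp x_inj (homo_ltn_inj h_homo).
  by apply: (hl [:: i; j]) => //=; rewrite ij.
have notlinked a b : a < b -> ~ linked R (x (h a)) (x (h b)).
  by move=> ab; apply: (hn [:: a; b]) => //=; rewrite ab.
have [F1 h1] := not_linked (notlinked 0 1 isT).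
have [F2 h2] := not_linked (notlinked 1 2 isT).
have [F3 h3] := not_linked (notlinked 0 2 isT).
have [|u [+ _]] := gP (h 0) (h 1) (h 2) (F1 ++ F2 ++ F3); first by rewrite !h_homo.
by rewrite !mem_cat !negb_or => /and3P[/h1 n1 /h2 n2 /h3 n3] [].
Qed.

Lemma low_step_irrefl m r : 0 < m -> irreflexive (low_step m r).
Proof. by move=> m0 v; rewrite /low_step shift_irrefl // !andbF. Qed.

Lemma high_step_irrefl m r : 0 < r -> irreflexive (high_step m r).
Proof. by move=> r0 v; rewrite /high_step shift_irrefl // !andbF. Qed.

Lemma low_step_shift m r v w : low_step m r v w -> shift m v.1 w.1.
Proof. by case/and4P. Qed.

Lemma high_step_shift m r v w : high_step m r v w -> shift r v.2 w.2.
Proof. by case/and4P. Qed.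

Lemma inl_inj (A B : Type) : injective (@inl A B).
Proof. by move=> x y []. Qed.

(** [E] is a single shift graph, with m = k - 2 and empty second coordinates. Its steps are red, and
    a red path of length [m] between two blocks is closed by a new vertex. *)
Lemma odd_even_cycles (k l : nat) : 4 <= k -> 4 <= l -> odd k -> ~~ odd l ->
  realizable 3 (cycle_graph k) (cycle_graph l).
Proof.
move=> k4 l4 ok evl; have [m kE] : exists m, k = m.+2 by exists (k - 2); lia.
have m0 : 0 < m by lia.
exists (seq nat * seq nat)%type, (low_step m 0); split; first exact: low_step_irrefl.
  move/(_ [rel v w | low_step m 0 v w || low_step m 0 w v] (fun _ _ => false)).
  case=> //.
  - by move=> v w; rewrite /= orbC.
  - by move=> v w /= ->.
  - by apply: (shift_no_odd_cycle (@low_step_shift m 0)) => //; lia.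
  - by move/cycle_walk => -[|x [_ /(_ 0)]] //; lia.
move=> R B Rs Bs cov; apply: contrapT => /not_orP[noR noB].
have [g [g_homo gP]] := homogeneous_low 0 (fun v w => R (inl v) (inl w)) m0.
have g_inj := homo_ltn_inj g_homo.
pose e (v : dseq) : dseq + seq dseq * nat := inl (dmap g v).
have e_inj : injective e by exact: inj_comp (@inl_inj _ _) (dmap_inj g_inj).
case: gP => gP; last first.
  have eB v w : low_step m 0 v w -> B (e v) (e w).
    move=> vw; have /negP/negPf nR := gP v w vw.
    by have := cov (e v) (e w) (low_step_map g_homo m0 vw); rewrite nR.
  (* Every [a i] has a step to every [b j], since they share the [m - 1] middle entries; blue steps
     thus contain large complete bipartite graphs. *)
  pose a i : dseq := (i :: iota l m.-1, [::]).
  pose b j : dseq := (rcons (iota l m.-1) (l + m + j), [::]).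
  apply: noB; apply: (hcopy_bipartite_cycle (a := e \o a) (b := e \o b)) => //.
  - by move=> i j _ _ /e_inj[].
  - by move=> i j _ _ /e_inj[] /rcons_inj[] /addnI.
  - move=> i j il jl; apply/eqP => /e_inj[] /(congr1 (head 0)) /=.
    by case: (m.-1) => [|m'] /=; lia.
  - move=> i j il jl; apply: eB; rewrite /low_step /= cats0 last_rcons /shift /=.
    rewrite size_iota prednK // last_rcons !eqxx /= !andbT ?andbb.
    rewrite (path_sortedE ltn_trans); apply/andP; split.
      by apply/allP => x; rewrite mem_rcons inE mem_iota; lia.
    rewrite -cats1; change (sorted ltn (iota l m.-1 ++ [:: l + m + j])).
    apply: (@sorted_cat_bound _ _ (l + m)); rewrite ?iota_ltn_sorted //.
      by move=> x; rewrite mem_iota; lia.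
    by move=> x; rewrite inE; lia.
pose G := m.+1 * 1 + m; pose S i := dmap g (block m 0 G 0 i).
have S_inj : injective S.
  have hd a : head 0 (iota a m) = a by rewrite -(prednK m0).
  move=> i j /(dmap_inj g_inj)[] /(congr1 (head 0)); rewrite !hd => /eqP.
  by rewrite eqn_pmul2r /G ?addnS ?muln1 // => /eqP.
have [h [h_homo hP]] := two_red_edges Rs Bs cov (leqnn 3) S_inj l4 evl noB.
have arc i j u : i < j -> is_fresh u ->
    R (inl (S (h i))) u /\ R u (inl (S (h j))) -> False.
  move=> /h_homo ij u_fresh [iu uj]; apply: noR.
  have [||||x [x0 xp x_inj xP]] := @low_path m 0 G ((h j).+2 * G) m (h i) (h j) => //.
    by rewrite m0 leqnn.
  rewrite kE; apply: (hcopy_cone_cycle (x := e \o x) (z := u)) => //.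
  - by move=> a b _ _ /e_inj/x_inj.
  - by move=> a _; case: u u_fresh {iu uj}.
  - by move=> a am; apply/gP/xP.
  - by rewrite /= x0 Rs.
  - by rewrite /= xp.
have [u [_ uf]] := hP (fun i => inl (S (h i))) (fun=> erefl) 0 1 2 [::] isT.
by case; [apply: (arc 0 1 u) | apply: (arc 1 2 u) | apply: (arc 0 2 u)].
Qed.

(** With 2m = k + 1 and 2r = l + 1, red low steps and blue high steps form a good coloring of [E].
    For an arbitrary coloring, two refinements, the second inside the first, leave one color on each
    type. *)
Lemma odd_odd_cycles (k l : nat) : 5 <= k -> k <= l -> odd k -> odd l ->
  realizable 3 (cycle_graph k) (cycle_graph l).
Proof.
move=> k5 kl ok ol.
have [m kE] : exists m, k.+1 = m.*2 by exists k.+1./2; lia.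
have [r lE] : exists r, l.+1 = r.*2 by exists l.+1./2; lia.
have m0 : 0 < m by lia.
have r0 : 0 < r by lia.
exists (seq nat * seq nat)%type, [rel v w | low_step m r v w || high_step m r v w]; split.
- by move=> v; rewrite /= low_step_irrefl // high_step_irrefl.
- move/(_ [rel v w | low_step m r v w || low_step m r w v]
          [rel v w | high_step m r v w || high_step m r w v]).
  case.
  + by move=> v w; rewrite /= orbC.
  + by move=> v w; rewrite /= orbC.
  + by move=> v w /= /orP[->|->] //; rewrite ?orbT.
  + by apply: (shift_no_odd_cycle (@low_step_shift m r)) => //; lia.
  + by apply: (shift_no_odd_cycle (@high_step_shift m r)) => //; lia.
move=> R B Rs Bs cov; apply: contrapT => /not_orP[noR noB].
have [g1 [g1_homo g1P]] := homogeneous_low r (fun v w => R (inl v) (inl w)) m0.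
have [g2 [g2_homo g2P]] := homogeneous_high m (fun v w => R (inl (dmap g1 v)) (inl (dmap g1 w))) r0.
pose e (v : dseq) : dseq + seq dseq * nat := inl (dmap g1 (dmap g2 v)).
have e_inj : injective e.
  have g1_inj := homo_ltn_inj g1_homo; have g2_inj := homo_ltn_inj g2_homo.
  exact: inj_comp (@inl_inj _ _) (inj_comp (dmap_inj g1_inj) (dmap_inj g2_inj)).
have dich (S : rel dseq) : (forall v w, S v w -> low_step m r v w || high_step m r v w) ->
    (forall v w, S v w -> R (e v) (e w)) \/ (forall v w, S v w -> ~ R (e v) (e w)) ->
    (forall v w, S v w -> R (e v) (e w)) \/ (forall v w, S v w -> B (e v) (e w)).
  move=> SE [|nR]; [by left | right=> v w vw].
  have /negP/negPf nRvw := nR v w vw.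
  have := cov (e v) (e w); rewrite nRvw /=; apply.
  by case/orP: (SE v w vw) => vw'; apply/orP; [left|right];
    do ?[apply: low_step_map | apply: high_step_map].
have lowP := dich (low_step m r) (fun v w vw => introT orP (or_introl vw)) _.
have {}lowP : (forall v w, low_step m r v w -> R (e v) (e w)) \/
    (forall v w, low_step m r v w -> B (e v) (e w)).
  by apply: lowP; case: g1P => h; [left|right] => v w /(low_step_map g2_homo m0)/h.
have highP : (forall v w, high_step m r v w -> R (e v) (e w)) \/
    (forall v w, high_step m r v w -> B (e v) (e w)).
  by apply: dich g2P => v w ->; rewrite orbT.
have not_all_red : ~ ((forall v w, low_step m r v w -> R (e v) (e w)) /\
               (forall v w, high_step m r v w -> R (e v) (e w))).
  by case=> h1 h2; apply: noR; apply: (both_steps_cycle Rs e_inj _ _ _ h1 h2) => //; lia.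
have not_all_blue : ~ ((forall v w, low_step m r v w -> B (e v) (e w)) /\
               (forall v w, high_step m r v w -> B (e v) (e w))).
  by case=> h1 h2; apply: noB; apply: (both_steps_cycle Bs e_inj _ _ _ h1 h2) => //; lia.
(* This spacing fits paths of both types up to length l - 2, and [4 * G] suffices for blocks of
   index at most 2. *)
pose G := l.+1 * (m + r).+1; pose N := 4 * G.
pose x i := e (block m r G N i).
pose A : seq dseq := [seq dmap g1 (dmap g2 (block m r G N i)) | i <- iota 0 3].
pose u : dseq + seq dseq * nat := inr (A, 0).
have ux i : i < 3 -> R u (x i) || B u (x i).
  move=> i3; apply: (fresh_cover (d := 3) 0 Rs Bs cov) => //.
  by apply/mapP; exists i; rewrite ?mem_iota.
have low_arc (Q : rel (dseq + seq dseq * nat)) n i j : symmetric Q -> m.+2 <= n <= l ->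
    (forall v w, low_step m r v w -> Q (e v) (e w)) -> i < j < 3 ->
    Q u (x i) -> Q u (x j) -> hcopy (cycle_graph n) Q.
  move=> Qs /andP[mn nl] lQ /andP[ij j3] ui uj.
  have [p nE] : exists p, n = p.+2 by exists (n - 2); lia.
  have [||||y [y0 yp y_inj yP]] := @low_path m r G N p i j => //.
  - by rewrite m0; lia.
  - have : p.+1 * r.+1 <= l * (m + r).+1 by apply: leq_mul; lia.
    by rewrite /G mulSn; lia.
  - by rewrite /N leq_mul2r; lia.
  rewrite nE; apply: (hcopy_cone_cycle (x := e \o y) (z := u)) => //.
  - by move=> a b _ _ /e_inj/y_inj.
  - by move=> a ap; apply/lQ/yP.
  - by rewrite /= y0.
  - by rewrite /= yp.
have high_arc (Q : rel (dseq + seq dseq * nat)) n i j : symmetric Q -> r.+2 <= n <= l ->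
    (forall v w, high_step m r v w -> Q (e v) (e w)) -> i < j < 3 ->
    Q u (x i) -> Q u (x j) -> hcopy (cycle_graph n) Q.
  move=> Qs /andP[mn nl] lQ /andP[ij j3] ui uj.
  have [p nE] : exists p, n = p.+2 by exists (n - 2); lia.
  have [||||y [y0 yp y_inj yP]] := @high_path m r G N p i j => //.
  - by rewrite r0; lia.
  - have : p.+1 * m.+1 <= l * (m + r).+1 by apply: leq_mul; lia.
    by rewrite /G mulSn; lia.
  - by rewrite /N leq_mul2r; lia.
  rewrite nE; apply: (hcopy_cone_cycle (x := e \o y) (z := u)) => //.
  - by move=> a b _ _ /e_inj/y_inj.
  - by move=> a ap; apply/lQ/yP.
  - by rewrite /= y0.
  - by rewrite /= yp.
have pigeon (P Q : Prop) : (forall i j, i < j < 3 -> R u (x i) -> R u (x j) -> P) ->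
    (forall i j, i < j < 3 -> B u (x i) -> B u (x j) -> Q) -> P \/ Q.
  move=> hP hQ; have /orP[red0|blue0] := ux 0 isT; have /orP[r1|b1] := ux 1 isT.
  - by left; apply: (hP 0 1).
  - by have /orP[r2|b2] := ux 2 isT; [left; apply: (hP 0 2)|right; apply: (hQ 1 2)].
  - by have /orP[r2|b2] := ux 2 isT; [left; apply: (hP 1 2)|right; apply: (hQ 0 2)].
  - by right; apply: (hQ 0 1).
case: lowP => [lR|lB]; case: highP => [hR|hB].
- by apply: not_all_red.
- have [] := pigeon _ _ (fun i j ij => low_arc R k i j Rs _ lR ij)
                        (fun i j ij => high_arc B l i j Bs _ hB ij) => //; lia.
(* If k < l, then l > 2m and the blue low steps contain a cycle of length l. If k = l, the two types
   exchange their roles. *)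
- have [kl'|lk] := ltnP k l.
    by apply: noB; apply: (low_step_cycle Bs e_inj _ _ lB); lia.
  have [] := pigeon _ _ (fun i j ij => high_arc R k i j Rs _ hR ij)
                        (fun i j ij => low_arc B l i j Bs _ lB ij) => //; lia.
- by apply: not_all_blue.
Qed.

Theorem cycles_realizable (k l : nat) : 4 <= k -> 4 <= l ->
  realizable 3 (cycle_graph k) (cycle_graph l).
Proof.
move=> k4 l4; have [ok|ek] := boolP (odd k); have [ol|el] := boolP (odd l).
- have [kl|lk] := leqP k l; first by apply: odd_odd_cycles => //; lia.
  by apply/realizableC/odd_odd_cycles => //; lia.
- exact: odd_even_cycles.
- exact/realizableC/odd_even_cycles.
- exact: even_even_cycles.
Qed.

(** * Complete graphs against cycles *)

Lemma hcopy_complete_cone (V : eqType) (R : rel V) (n : nat) (f : 'I_n -> V) (z : V) :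
  symmetric R -> injective f -> (forall i j, i != j -> R (f i) (f j)) ->
  (forall i, f i != z) -> (forall i, R z (f i)) -> hcopy (complete n.+1) R.
Proof.
move=> Rs f_inj fR fz zR.
exists (fun i : 'I_n.+1 => if unlift ord0 i is Some j then f j else z); split.
- move=> i j; case: unliftP => [i'|] -> ; case: unliftP => [j'|] -> //.
  + by move/f_inj->.
  + by move/eqP; rewrite (negPf (fz _)).
  + by move/esym/eqP; rewrite (negPf (fz _)).
- move=> i j; case: unliftP => [i'|] -> ; case: unliftP => [j'|] ->; rewrite /= /complete_rel.
  + by rewrite (inj_eq lift_inj) => /fR.
  + by rewrite Rs.
  + by [].
  + by rewrite eqxx.
Qed.

(** There are n = t - 1 parts, and all red is a good coloring. Otherwise the edges between parts are
    red along a subsequence, as blue ones contain complete bipartite graphs; new vertices attached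
    to two transversals then link vertices of one part in blue. *)
Lemma complete_even_realizable (t l : nat) : 3 <= t -> 4 <= l -> ~~ odd l ->
  realizable (2 * (t - 1)) (complete t) (cycle_graph l).
Proof.
case: t => // n n2 l4 evl; rewrite subn1 /=.
pose E : rel (nat * nat) := fun x y => [&& x.1 < n, y.1 < n & x.1 != y.1].
exists (nat * nat)%type, E; split.
- by move=> x; rewrite /E eqxx !andbF.
- move/(_ E (fun _ _ => false)); case=> // [x y|x y -> //||].
  + by rewrite /E eq_sym; case: (_ < n); case: (_ < n).
  + case=> f [f_inj fP].
    have fn (i : 'I_n.+1) : (f i).1 < n.
      by have [j /fP/and3P[]] := complete_no_isolated (ltnW n2) i.
    pose g (i : 'I_n.+1) : 'I_n := Ordinal (fn i).
    have g_inj : injective g.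
      move=> i j /(congr1 val) /= ij; apply/eqP; apply: contraT => ne.
      by have /and3P[_ _] := fP i j ne; rewrite ij eqxx.
    by have := leq_card g g_inj; rewrite !card_ord ltnn.
  + by move/cycle_walk => -[|x [_ /(_ 0)]] //; lia.
move=> R B Rs Bs cov; apply: contrapT => /not_orP[noR noB].
pose v p i : nat * nat + seq (nat * nat) * nat := inl (p, i).
have [g [g_homo gP]] := ramsey_family [seq (p, q) | p <- iota 0 n, q <- iota 0 n] 2
  (fun pq s => B (v pq.1 (nth 0 s 0)) (v pq.2 (nth 0 s 1))).
have g_inj := homo_ltn_inj g_homo.
have red_lt p q i j : p < n -> q < n -> p != q -> i < j -> R (v p (g i)) (v q (g j)).
  move=> pn qn pq ij; have pqI : (p, q) \in [seq (p, q) | p <- iota 0 n, q <- iota 0 n].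
    by apply/allpairsP; exists (p, q); rewrite !mem_iota.
  case: (gP _ pqI) => [gB|/(_ [:: i; j])].
    case: noB; apply: (hcopy_bipartite_cycle (a := fun i => v p (g i))
      (b := fun j => v q (g (l + j)))) => //.
    - by move=> a b _ _ [] /g_inj.
    - by move=> a b _ _ [] /g_inj/addnI.
    - by move=> a b _ _; apply: contraNneq pq => -[->].
    - by move=> a b al _; apply: (gB [:: a; l + b]) => //=; rewrite andbT; lia.
  rewrite /= ij => /(_ isT erefl) /negP/negPf nB.
  by have := cov (v p (g i)) (v q (g j)); rewrite nB orbF; apply; rewrite /= /E pn qn.
(* Interleaving makes indices in different parts distinct, so [red_lt] compares any two of them. *)
pose x p i := g (i * n + p).
have red p q i j : p < n -> q < n -> p != q -> R (v p (x p i)) (v q (x q j)).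
  move=> pn qn pq; case: (ltngtP (i * n + p) (j * n + q)) => ij; first exact: red_lt.
    by rewrite Rs; apply: red_lt; rewrite // eq_sym.
  case/eqP: pq; have := congr1 (modn^~ n) ij.
  by rewrite !modnMDl !modn_small.
(* Otherwise a new vertex attached to transversals [i] and [j], outside the finite exceptional sets,
   has a red neighbour in every part and completes a red clique. *)
have link i j : i < j -> exists2 p, p < n & linked B (v p (x p i)) (v p (x p j)).
  move=> ij; apply: contrapT => /forall2NP no.
  have /choice[F FP] p : exists F : seq (nat * nat + seq (nat * nat) * nat), p < n ->
      forall u, u \notin F -> ~ (B (v p (x p i)) u /\ B u (v p (x p j))).
    have [pn|pn] := ltnP p n; last by exists [::]; lia.
    by case: (no p) => // /not_linked[F FP]; exists F.
  pose A : seq (nat * nat) := [seq (p, x p i) | p <- iota 0 n] ++ [seq (p, x p j) | p <- iota 0 n].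
  have [k ku] := fresh_avoid A (flatten [seq F p | p <- iota 0 n]).
  set u := inr (A, k) in ku.
  have cu y : y \in A -> R u (inl y) || B u (inl y).
    by apply: (fresh_cover k Rs Bs cov); rewrite size_cat !size_map !size_iota; lia.
  have /choice[y yP] (p : 'I_n) : exists y, R u (v p (x p y)).
    have pI : val p \in iota 0 n by rewrite mem_iota /=.
    have uF : u \notin F p.
      by apply: contra ku => uF; apply/flattenP; exists (F p) => //; apply/mapP; exists (val p).
    have Ai : (val p, x p i) \in A.
      by rewrite mem_cat; apply/orP; left; apply/mapP; exists (val p).
    have Aj : (val p, x p j) \in A.
      by rewrite mem_cat; apply/orP; right; apply/mapP; exists (val p).
    have /orP[Ri|Bi] := cu _ Ai; first by exists i.
    have /orP[Rj|Bj] := cu _ Aj; first by exists j.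
    by case: (FP p (ltn_ord p) u uF); rewrite Bs.
  apply: noR; apply: (hcopy_complete_cone (f := fun p : 'I_n => v p (x p (y p))) (z := u)) => //.
  - by move=> p q [] pq _; apply: val_inj.
  - by move=> p q pq; apply: red => //; rewrite ?ltn_ord.
(* The part found by [link] varies with the pair; after this refinement one linked pair in a part
   makes all pairs there linked. *)
have [h [h_homo hP]] := ramsey_family (iota 0 n) 2
  (fun p s => linked B (v p (x p (nth 0 s 0))) (v p (x p (nth 0 s 1)))).
have [|p pn pl] := link (h 0) (h 1); first exact: h_homo.
have pI : p \in iota 0 n by rewrite mem_iota.
case: (hP p pI) => [hl|/(_ [:: 0; 1] isT erefl)//].
apply: noB; apply: (linked_cycle (g := fun i => v p (x p (h i)))) => // [i j [] /g_inj|i j ij].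
  by move=> e; apply: (homo_ltn_inj h_homo); move: e => /addIn; nia.
by apply: (hl [:: i; j]) => //=; rewrite ij.
Qed.

(** * Copies of a graph joined by outer shift steps *)

Definition increasing (n : nat) (s : seq nat) : bool := (size s == n) && sorted ltn s.

Lemma increasing_map n g s : {homo g : x y / x < y} -> increasing n s -> increasing n (map g s).
Proof. by move=> g_homo /andP[sn ss]; rewrite /increasing size_map sn sorted_ltn_map. Qed.

Section Step.
Variables (a M : nat) (D : rel (seq nat)).

(* A vertex is an increasing sequence [u_1, ..., u_a, y, u_{a+1}] with [y] a vertex
   of [D].  Fixing [u_1, ..., u_a] gives copies of [D], whose vertices differ in
   [u_{a+1}]; the outer steps shift [u].  As [y] lies between the last two entries
   of [u], all outer steps have the same order type, and infinitely many choices
   of [u_{a+1}] remain above [y]. *)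
Definition hd (s : seq nat) := take a s.
Definition md (s : seq nat) := take M (drop a s).
Definition lst (s : seq nat) := nth 0 s (a + M).

Definition inner : rel (seq nat) := fun s s' =>
  [&& increasing (a + M).+1 s, increasing (a + M).+1 s', hd s == hd s',
      lst s != lst s' & D (md s) (md s')].

Definition outer : rel (seq nat) := fun s s' =>
  [&& increasing (a + M).+1 s, increasing (a + M).+1 s' &
      hd s' == behead (rcons (hd s) (lst s))].

Definition step : rel (seq nat) := fun s s' => inner s s' || outer s s'.

Lemma split_vertex s : increasing (a + M).+1 s -> s = hd s ++ md s ++ [:: lst s].
Proof.
move=> /andP[/eqP ss _]; rewrite /hd /md /lst -[LHS](cat_take_drop a); congr (_ ++ _).
rewrite -[LHS](cat_take_drop M); congr (_ ++ _).
by rewrite drop_drop addnC (drop_nth 0) ?ss // drop_oversize ?ss.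
Qed.

Lemma size_hd s : increasing (a + M).+1 s -> size (hd s) = a.
Proof. by move=> /andP[/eqP ss _]; rewrite size_takel // ss; lia. Qed.

Lemma size_md s : increasing (a + M).+1 s -> size (md s) = M.
Proof. by move=> /andP[/eqP ss _]; rewrite size_takel // size_drop ss; lia. Qed.

Lemma join_vertex h y c : size h = a -> size y = M -> let s := h ++ y ++ [:: c] in
  [/\ size s = (a + M).+1, hd s = h, md s = y & lst s = c].
Proof.
move=> sh sy /=; split; first by rewrite !size_cat /= sh sy; lia.
- by rewrite /hd take_size_cat.
- by rewrite /md drop_size_cat // take_size_cat.
- by rewrite /lst catA nth_cat size_cat sh sy ltnn subnn.
Qed.

Lemma hd_map g s : hd (map g s) = map g (hd s). Proof. exact/esym/map_take. Qed.
Lemma md_map g s : md (map g s) = map g (md s).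
Proof. by rewrite /md map_take map_drop. Qed.
Lemma lst_map g s : increasing (a + M).+1 s -> lst (map g s) = g (lst s).
Proof. by move=> /andP[/eqP ss _]; rewrite /lst (nth_map 0) // ss. Qed.

Lemma outer_map g s s' : {homo g : x y / x < y} -> outer s s' -> outer (map g s) (map g s').
Proof.
move=> g_homo /and3P[s1 s2 /eqP e]; rewrite /outer !increasing_map //=.
by rewrite !hd_map e lst_map // -map_rcons behead_map.
Qed.

Hypothesis D_map : forall g s s', {homo g : x y / x < y} -> D s s' -> D (map g s) (map g s').

Lemma inner_map g s s' : {homo g : x y / x < y} -> inner s s' -> inner (map g s) (map g s').
Proof.
move=> g_homo /and5P[s1 s2 /eqP e ne ss']; rewrite /inner !increasing_map //=.
by rewrite !hd_map e eqxx !lst_map // (inj_eq (homo_ltn_inj g_homo)) ne !md_map D_map.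
Qed.

Lemma step_map g s s' : {homo g : x y / x < y} -> step s s' -> step (map g s) (map g s').
Proof.
by move=> gh /orP[/(inner_map gh)|/(outer_map gh)] h; rewrite /step h ?orbT.
Qed.

Hypothesis a0 : 0 < a.

Lemma sorted_hd_lst s : increasing (a + M).+1 s -> sorted ltn (rcons (hd s) (lst s)).
Proof.
move=> si; have /andP[_] := si; rewrite {1}(split_vertex si); apply: (subseq_sorted ltn_trans).
by rewrite -cats1 cat_subseq // suffix_subseq // suffix_suffix.
Qed.

(** Forgetting [y] maps the outer steps into a shift graph, which bounds their odd girth. *)
Lemma outer_shift s s' : outer s s' ->
  shift a.+1 (rcons (hd s) (lst s)) (rcons (hd s') (lst s')).
Proof.
case/and3P=> s1 s2 /eqP hE.
have := sorted_hd_lst s2; have := sorted_hd_lst s1.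
rewrite hE /shift last_rcons size_rcons size_hd // eqxx.
have := size_hd s2; rewrite hE; case: (rcons (hd s) (lst s)) => [|x0 [|y z]] /=.
- by move=> ea; move: a0; rewrite -ea.
- by move=> ea; move: a0; rewrite -ea.
- by move=> _ /andP[-> _] ->; rewrite eqxx.
Qed.

Hypothesis D_inc : forall s s', D s s' -> increasing M s /\ increasing M s'.
Hypothesis D_irr : irreflexive D.

Lemma step_increasing s s' : step s s' -> increasing (a + M).+1 s /\ increasing (a + M).+1 s'.
Proof. by case/orP => [/and5P[]|/and3P[]]. Qed.

Lemma step_irrefl : irreflexive step.
Proof.
move=> s; apply/negbTE; rewrite negb_or; apply/andP; split.
  by apply/negP=> /and5P[_ _ _]; rewrite eqxx.
by apply/negP=> /outer_shift; rewrite shift_irrefl.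
Qed.

(** Middle parts of adjacent vertices differ because [D] is irreflexive, so a clique keeps its
    size. *)
Lemma inner_complete n : hcopy (complete n) [rel s s' | inner s s' || inner s' s] ->
  hcopy (complete n) [rel y y' | D y y' || D y' y].
Proof.
case=> f [f_inj fP].
have DP x y : edge x y -> D (md (f x)) (md (f y)) || D (md (f y)) (md (f x)).
  by move/fP/orP => [] /and5P[_ _ _ _ ->]; rewrite ?orbT.
exists (fun x => md (f x)); split=> // x y xy; apply/eqP; apply: contraT => ne.
by have := DP x y ne; rewrite xy D_irr.
Qed.

(* The vertices of a clique with the least first entry either exhaust it, or
   there is one of them and the others all continue it in the same copy of [D]. *)
Lemma step_complete (j n : nat) : a = 1 ->
  (forall n', hcopy (complete n') [rel y y' | D y y' || D y' y] -> n' <= j) ->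
  hcopy (complete n) [rel s s' | step s s' || step s' s] -> n <= j.+1.
Proof.
move=> a1 Dj [f [f_inj fP]]; case: n f f_inj fP => [|[|n]] // f f_inj fP.
have f_inc x : increasing (a + M).+1 (f x).
  have [y /fP/orP[]/step_increasing[]//] := @complete_no_isolated n.+2 isT x.
pose al x := head 0 (f x); pose be x := lst (f x).
have hdE x : hd (f x) = [:: al x].
  have := size_hd (f_inc x); rewrite /al {3}(split_vertex (f_inc x)) a1.
  by case: (hd (f x)) => [|? []].
have albe x : al x < be x.
  have /andP[_] := f_inc x; rewrite (split_vertex (f_inc x)) hdE /= (path_sortedE ltn_trans).
  by case/andP=> /allP h _; apply: h; rewrite mem_cat mem_head orbT.
have outE x y : outer (f x) (f y) -> al y = be x.
  by case/and3P=> _ _; rewrite !hdE => /eqP[].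
have inE' x y : inner (f x) (f y) -> al x = al y /\ be x <> be y.
  by case/and5P=> _ _; rewrite !hdE => /eqP[->] /eqP.
have eqal x y : edge x y -> al x = al y -> inner (f x) (f y) || inner (f y) (f x).
  move=> /fP/orP[]/orP[->|/outE e] //; rewrite ?orbT // => xy.
    by have := albe x; rewrite -e xy ltnn.
  by have := albe y; rewrite -e xy ltnn.
have neqal x y : al x < al y -> al y = be x.
  move=> xy; have /fP/orP[] : @edge (complete n.+2) x y.
    by apply/eqP => e; rewrite e ltnn in xy.
  - by case/orP=> [/inE'[e _]|/outE //]; rewrite e ltnn in xy.
  - case/orP=> [/inE'[e _]|/outE e]; first by rewrite e ltnn in xy.
    by have := albe y; rewrite -e ltnNge ltnW.
have [i0 _ i0P] : exists2 i0 : 'I_n.+2, true & forall i, al i0 <= al i.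
  by case: (@arg_minnP _ ord0 xpredT al isT) => i0 _ h; exists i0 => // i; apply: h.
have [all_eq|] := pselect (forall z, al z = al i0).
  apply: leqW; apply: Dj; apply: inner_complete; exists f; split=> // x y xy /=.
  by apply: eqal; rewrite // !all_eq.
move/existsNP=> [z /eqP zi0].
have iz : al i0 < al z by rewrite ltn_neqAle eq_sym zi0 i0P.
have ze := neqal _ _ iz.
have ye y : y != i0 -> al y = be i0.
  move=> yi; have [yal|/eqP] := eqVneq (al y) (al i0); last first.
    by move/eqP=> ne; apply: neqal; rewrite ltn_neqAle eq_sym ne i0P.
  have yz : al y < al z by rewrite yal.
  have := neqal _ _ yz; rewrite ze => e.
  by have /orP[] := eqal _ _ yi yal => /inE'[_]; rewrite e.
rewrite ltnS; apply: Dj; apply: inner_complete.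
exists (fun x : 'I_n.+1 => f (lift i0 x)); split=> [x y /f_inj/lift_inj //|x y xy /=].
apply: eqal; first by rewrite /= /complete_rel (inj_eq lift_inj).
by rewrite !ye // eq_sym neq_lift.
Qed.

End Step.

(** * Forcing a larger red clique or blue outer steps *)

Section Forcing.
Variables (a M l n : nat) (D : rel (seq nat)).
Hypotheses (a0 : 0 < a) (l3 : 3 <= l).
Hypotheses (D_map : forall g s s', {homo g : x y / x < y} -> D s s' -> D (map g s) (map g s')).
Hypothesis D_inc : forall s s', D s s' -> increasing M s /\ increasing M s'.
Hypothesis D_irr : irreflexive D.
(** The vertices are required to be increasing because a clique on one vertex has no edge that would
    ensure it. *)
Hypothesis D_forced : forall R B : rel (seq nat), symmetric R -> symmetric B ->
  (forall s s', D s s' -> R s s' || B s s') ->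
  (exists f : 'I_n -> seq nat, [/\ injective f, forall i, increasing M (f i) &
     forall i j, i != j -> R (f i) (f j)]) \/ hcopy (cycle_graph l) B.

Notation outer := (outer a M).
Notation step := (step a M D).

(** The first [a] entries of [s'] are entries of [s] and end with the largest one, so [s] followed
    by the rest of [s'] is an increasing sequence that codes the step. *)
Lemma homogeneous_outer (Q : rel (seq nat)) : exists g : nat -> nat, {homo g : x y / x < y} /\
  ((forall s s', outer s s' -> Q (map g s) (map g s')) \/
   (forall s s', outer s s' -> ~ Q (map g s) (map g s'))).
Proof.
pose N := (a + M).+1.
pose dec (w : seq nat) := (take N w, behead (rcons (take a w) (nth 0 w (a + M))) ++ drop N w).
have decP g s s' : outer s s' -> exists w, [/\ sorted ltn w, size w = N + M.+1 &
    dec (map g w) = (map g s, map g s')].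
  case/and3P=> s1 s2 /eqP hE; have /andP[/eqP z1 o1] := s1; have /andP[/eqP z2 o2] := s2.
  have sE' := cat_take_drop a s'; exists (s ++ drop a s'); split.
  - have lE : lst a M s \in take a s'.
      move: hE; rewrite /hd -/(hd a s) => ->.
      case: (hd a s) (size_hd s1) => [|x h] /=; first by move=> e; move: a0; rewrite -e.
      by rewrite mem_rcons inE eqxx.
    have le_l x : x \in s -> x <= lst a M s.
      move: o1; rewrite {1 2}(split_vertex s1) catA sorted_catE => /and3P[/allrelP h _ _].
      rewrite mem_cat => /orP[xs|]; last by rewrite inE => /eqP->.
      by apply/ltnW/h; rewrite ?inE.
    have gt_l y : y \in drop a s' -> lst a M s < y.
      by move: o2; rewrite -{1}sE' sorted_catE => /and3P[/allrelP h _ _] ys; apply: h.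
    rewrite sorted_catE o1 /=; apply/andP; split; last first.
      by move: o2; rewrite -{1}sE' sorted_catE => /and3P[].
    by apply/allrelP => x y /le_l xl /gt_l; apply: leq_ltn_trans.
  - by rewrite size_cat size_drop z1 z2 /N; lia.
  - rewrite /dec map_cat take_size_cat ?size_map // drop_size_cat ?size_map //; congr (_, _).
    rewrite -[in RHS]sE' map_cat; congr (_ ++ _); rewrite -[take a s']/(hd a s') hE.
    rewrite -behead_map map_rcons; congr (behead (rcons _ _)).
      by rewrite take_cat size_map z1 ifT ?map_take //; lia.
    by rewrite nth_cat size_map z1 ltnS leqnn (nth_map 0) // z1.
have [g [g_homo gP]] := ramsey (N + M.+1) (fun w => Q (dec w).1 (dec w).2).
exists g; split=> //; case: gP => gP; [left|right] => s s' /(decP g)[w [ws wz de]];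
  by have := gP w ws wz; rewrite de.
Qed.

Variables (W : eqType) (R B : rel W) (e : seq nat -> W).
Hypotheses (Rs : symmetric R) (Bs : symmetric B) (e_inj : injective e).
Hypothesis cov : forall s s', step s s' -> R (e s) (e s') || B (e s) (e s').
Hypothesis noB : ~ hcopy (cycle_graph l) B.

(** The last entry is a code of the middle part: it exceeds the entries of [y] and differs for
    different [y], as [inner] demands. *)
Definition copy_vertex (h : seq nat) (K : nat) (y : seq nat) : seq nat :=
  h ++ map (addn K) y ++ [:: CodeSeq.code (map (addn K) y) + K].

Lemma copy_vertex_increasing h K y : increasing a h -> {in h, forall x, x < K} ->
  increasing M y -> increasing (a + M).+1 (copy_vertex h K y).
Proof.
move=> /andP[/eqP sh oh] hK /andP[/eqP sy oy]; rewrite /increasing /copy_vertex.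
rewrite !size_cat size_map sh sy addn1 -addnS eqxx.
have lt z : z \in map (addn K) y -> z < CodeSeq.code (map (addn K) y).
  move=> zy; have := CodeSeq.gtn_decode (CodeSeq.code (map (addn K) y)).
  by rewrite CodeSeq.codeK => /allP/(_ z zy).
apply: (@sorted_cat_bound _ _ K) => //.
  apply: (@sorted_cat_bound _ _ (CodeSeq.code (map (addn K) y) + K)) => //.
  - by apply: sorted_ltn_map => // x z; rewrite ltn_add2l.
  - by move=> z /lt; lia.
  - by move=> z; rewrite inE => /eqP->.
by move=> z; rewrite mem_cat inE => /orP[/mapP[x _ ->]|/eqP->]; lia.
Qed.

Lemma copy_vertex_parts h K y : increasing a h -> increasing M y -> let s := copy_vertex h K y in
  [/\ hd a s = h, md a M s = map (addn K) y & lst a M s = CodeSeq.code (map (addn K) y) + K].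
Proof.
move=> /andP[/eqP sh _] /andP[/eqP sy _] /=.
have sy' : size (map (addn K) y) = M by rewrite size_map.
by have [_ -> -> ->] := join_vertex (CodeSeq.code (map (addn K) y) + K) sh sy'.
Qed.

Lemma copy_vertex_inj h K : {in increasing M &, injective (copy_vertex h K)}.
Proof.
move=> y y'; rewrite /in_mem /= => /andP[/eqP sy _] /andP[/eqP sy' _] /eqP.
rewrite /copy_vertex eqseq_cat // eqxx /= eqseq_cat ?size_map ?sy ?sy' // => /andP[/eqP + _].
by apply: inj_map; apply: addnI.
Qed.

Lemma inner_copy h K y y' : increasing a h -> {in h, forall x, x < K} -> D y y' ->
  inner a M D (copy_vertex h K y) (copy_vertex h K y').
Proof.
move=> ih hK yy'; have [iy iy'] := D_inc yy'.
rewrite /inner !copy_vertex_increasing //.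
have [-> -> ->] := copy_vertex_parts K ih iy; have [-> -> ->] := copy_vertex_parts K ih iy'.
rewrite eqxx D_map //= ?andbT; last by move=> x z; rewrite ltn_add2l.
rewrite eqn_add2r; apply/eqP => /(can_inj CodeSeq.codeK)/(inj_map (@addnI K)) yE.
by rewrite yE D_irr in yy'.
Qed.

Lemma red_clique_in_copy (g : nat -> nat) h K : {homo g : x y / x < y} -> increasing a h ->
  {in h, forall x, x < K} -> exists f : 'I_n -> seq nat,
  [/\ injective f, forall i, increasing (a + M).+1 (f i), forall i, hd a (f i) = h,
    forall i, K <= lst a M (f i) & forall i j, i != j -> R (e (map g (f i))) (e (map g (f j)))].
Proof.
move=> g_homo ih hK; pose c y := e (map g (copy_vertex h K y)).
(* Blue is restricted to increasing sequences, on which [copy_vertex] is injective. *)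
case: (@D_forced (fun y y' => R (c y) (c y'))
  (fun y y' => [&& increasing M y, increasing M y' & B (c y) (c y')])).
- by move=> y y'; rewrite Rs.
- by move=> y y'; rewrite Bs andbCA.
- move=> y y' yy'; have [-> ->] := D_inc yy'; apply: cov; apply: step_map => //.
  by rewrite /step inner_copy.
- case=> f [f_inj fi fR]; exists (fun i => copy_vertex h K (f i)); split=> // [i j|i|i|i].
  + by move/copy_vertex_inj => /(_ (fi i) (fi j))/f_inj.
  + exact: copy_vertex_increasing.
  + by have [] := copy_vertex_parts K ih (fi i).
  + by have [_ _ ->] := copy_vertex_parts K ih (fi i); rewrite leq_addl.
- case=> f [f_inj fP]; case: noB; exists (fun x => c (f x)); split=> [x y|x y /fP/and3P[] //].
  have fi z : increasing M (f z).
    by have [z' /fP/and3P[]] := cycle_no_isolated l3 z.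
  by move/e_inj/(inj_map (homo_ltn_inj g_homo))/copy_vertex_inj => /(_ (fi x) (fi y))/f_inj.
Qed.

Lemma increasing_iota b k : increasing k (iota b k).
Proof. by rewrite /increasing size_iota eqxx iota_ltn_sorted. Qed.

(** If outer steps are red, a vertex sends red edges to all vertices whose head is its shift, hence
    to a whole copy of [D], and a red clique there gains one vertex. *)
Lemma forced_red_or_blue_outer :
  (exists f : 'I_n.+1 -> seq nat, [/\ injective f, forall i, increasing (a + M).+1 (f i) &
     forall i j, i != j -> R (e (f i)) (e (f j))]) \/
  exists g : nat -> nat, {homo g : x y / x < y} /\
    forall s s', outer s s' -> B (e (map g s)) (e (map g s')).
Proof.
have [g [g_homo [gB|gR]]] := homogeneous_outer (fun s s' => B (e s) (e s')).
  by right; exists g.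
left; have redP s s' : outer s s' -> R (e (map g s)) (e (map g s')).
  move=> ss'; have := cov (step_map D_map g_homo (introT orP (or_intror ss'))).
  by case/orP => // /(gR _ _ ss').
pose x0 := iota 0 (a + M).+1; have x0i : increasing (a + M).+1 x0 by apply: increasing_iota.
pose h := behead (rcons (hd a x0) (lst a M x0)).
have hd0 : hd a x0 = iota 0 a by rewrite /hd take_iota; congr (iota _ _); lia.
have lst0 : lst a M x0 = a + M by rewrite /lst nth_iota.
have ih : increasing a h.
  rewrite /h hd0 lst0 /increasing size_behead size_rcons size_iota eqxx /=.
  rewrite -[X in behead X]cats1; have : sorted ltn (iota 0 a ++ [:: a + M]).
    apply: (@sorted_cat_bound _ _ a); rewrite ?iota_ltn_sorted // => x; rewrite ?mem_iota //.
    by rewrite inE => /eqP->; rewrite leq_addr.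
  by case: (_ ++ _) => //= x s /path_sorted.
have hlt x : x \in h -> x < (a + M).+1.
  move/mem_behead; rewrite mem_rcons hd0 lst0 inE mem_iota; lia.
(* [x0] starts with 0 and is therefore not in the clique that it extends. *)
have h1 : 0 < head 0 h.
  by rewrite /h hd0 lst0; case: (a) a0 => [|[|k]].
have [f [f_inj fi fh _ fR]] := red_clique_in_copy g_homo ih hlt.
have hdf i : 0 < head 0 (f i).
  rewrite (split_vertex (fi i)) fh; move: h1; case: (h) (andP ih).1 => //.
pose F (i : 'I_n.+1) := if unlift ord0 i is Some j then f j else x0.
have f0 i : f i <> x0 by move=> e0; have := hdf i; rewrite e0.
have Fi i : increasing (a + M).+1 (F i) by rewrite /F; case: unliftP => // j _.
have red0 i : R (e (map g x0)) (e (map g (f i))) by apply: redP; rewrite /outer x0i fi fh eqxx.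
exists (fun i => map g (F i)); split.
- move=> i j /(inj_map (homo_ltn_inj g_homo)); rewrite /F.
  case: unliftP => [i'|] ->; case: unliftP => [j'|] ->.
  + by move/f_inj->.
  + by move/f0.
  + by move/esym/f0.
  + by [].
- by move=> i; apply: increasing_map.
- move=> i j; rewrite /F; case: unliftP => [i'|] ->; case: unliftP => [j'|] -> //.
  + by rewrite (inj_eq lift_inj) => /fR.
  + by rewrite Rs.
Qed.

End Forcing.

(** For [a = 1] outer steps lead from (i, j) to (j, k), written without [y]. The path (0,1), (1,2),
    ..., (p,p+1) is closed by (1,p); p >= 3 keeps this vertex off the path. *)
Lemma outer_cycle (M l : nat) (W : eqType) (R : rel W) (c : seq nat -> W) : 5 <= l ->
  symmetric R -> injective c -> (forall s s', outer 1 M s s' -> R (c s) (c s')) ->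
  hcopy (cycle_graph l) R.
Proof.
move=> l5 Rs c_inj oR; pose x i j := (i * M.+1) :: iota (i * M.+1).+1 M ++ [:: j * M.+1].
have lt_mul i j : i < j -> i * M.+1 + M < j * M.+1.
  by move=> ij; have := leq_mul2r M.+1 i.+1 j; rewrite ij orbT mulSn; lia.
have parts i j : [/\ size (x i j) = (1 + M).+1, hd 1 (x i j) = [:: i * M.+1],
    md 1 M (x i j) = iota (i * M.+1).+1 M & lst 1 M (x i j) = j * M.+1].
  by apply: (@join_vertex 1 M [:: i * M.+1]) => //; rewrite size_iota.
have inc i j : i < j -> increasing (1 + M).+1 (x i j).
  move=> /lt_mul ij; have [sx _ _ _] := parts i j; rewrite /increasing sx eqxx.
  apply: (@sorted_cat_bound (iota (i * M.+1) M.+1) _ (i * M.+1 + M).+1) => //.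
  - exact: iota_ltn_sorted.
  - by move=> z; rewrite mem_iota; lia.
  - by move=> z; rewrite inE => /eqP->.
have out i j k : i < j -> j < k -> R (c (x i j)) (c (x j k)).
  move=> ij jk; apply: oR; have [_ hi _ li] := parts i j; have [_ hj _ _] := parts j k.
  by rewrite /outer !inc // hi li hj /= eqxx.
have x_inj i j i' j' : x i j = x i' j' -> i = i' /\ j = j'.
  have [_ h1 _ l1] := parts i j; have [_ h2 _ l2] := parts i' j'.
  move=> e; have := congr1 (hd 1) e; have := congr1 (lst 1 M) e.
  by rewrite h1 h2 l1 l2 => /eqP + [/eqP]; rewrite !eqn_mul2r => /eqP-> /eqP->.
have [p lE] : exists p, l = p.+2 by exists (l - 2); lia.
rewrite lE; apply: (hcopy_cone_cycle (x := fun i => c (x i i.+1)) (z := c (x 1 p))) => //.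
- by move=> i j _ _ /c_inj/x_inj[].
- by move=> i _; apply/eqP => /c_inj/x_inj[]; lia.
- by move=> i _; apply: out.
- by rewrite Rs; apply: out; lia.
- by apply: out; lia.
Qed.

(** Level 0 is edgeless, with the empty sequence as its only increasing vertex. Each level adds one
    to the bound on cliques and to the forced red clique; short odd cycles do not matter here, so
    [a = 1] suffices. *)
Fixpoint nested (j : nat) : rel (seq nat) :=
  if j is i.+1 then step 1 i.*2 (nested i) else fun _ _ => false.

Lemma nested_map j g s s' : {homo g : x y / x < y} -> nested j s s' ->
  nested j (map g s) (map g s').
Proof. by elim: j g s s' => //= j IH g s s' g_homo; apply: step_map. Qed.

Lemma nested_increasing j s s' : nested j s s' -> increasing j.*2 s /\ increasing j.*2 s'.
Proof. by case: j => //= j /step_increasing. Qed.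

Lemma nested_irrefl j : irreflexive (nested j).
Proof. by case: j => //= j; apply: step_irrefl. Qed.

Lemma nested_complete j n : hcopy (complete n) [rel y y' | nested j y y' || nested j y' y] ->
  n <= j.+1.
Proof.
elim: j n => [|j IH] n.
  case: n => [|[|n]] // [f [_ fP]].
  by have [y /fP] := @complete_no_isolated n.+2 isT ord0.
by apply: step_complete => //; apply: nested_irrefl.
Qed.

(** Blue outer steps would contain the cycle, so each level enlarges the red clique by one
    vertex. *)
Lemma nested_forced j l (R B : rel (seq nat)) : 5 <= l -> symmetric R -> symmetric B ->
  (forall s s', nested j s s' -> R s s' || B s s') ->
  (exists f : 'I_j.+1 -> seq nat, [/\ injective f, forall i, increasing j.*2 (f i) &
     forall i i', i != i' -> R (f i) (f i')]) \/ hcopy (cycle_graph l) B.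
Proof.
move=> l5; elim: j R B => [|j IH] R B Rs Bs cov.
  left; exists (fun=> [::]); split=> // i i'; rewrite ?(ord1 i) ?(ord1 i') //.
have [noB|hB] := pselect (~ hcopy (cycle_graph l) B); last by right; apply: contrapT.
have l3 : 3 <= l by lia.
have [[f fP]|[g [g_homo gB]]] := forced_red_or_blue_outer (isT : 0 < 1) l3 (@nested_map j)
  (@nested_increasing j) (@nested_irrefl j) IH Rs Bs (@inj_id _) cov noB; first by left; exists f.
by case: noB; apply: (outer_cycle l5 Bs (inj_map (homo_ltn_inj g_homo)) gB).
Qed.

(** The path follows the windows of length a + 1 in [w], the outer entries of [s] followed by those
    of [s']. *)
Lemma outer_path (a M K : nat) (s s' : seq nat) : 0 < a ->
  increasing (a + M).+1 s -> increasing (a + M).+1 s' ->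
  lst a M s + M < K -> hd a s' = mkseq (fun i => K + i * M.+1) a ->
  exists x : nat -> seq nat, [/\ x 0 = s, x a.+1 = s',
    forall i j, i <= a.+1 -> j <= a.+1 -> x i = x j -> i = j &
    forall i, i < a.+1 -> outer a M (x i) (x i.+1)].
Proof.
move=> a0 si s'i sK hE; have sh := size_hd si; have sh' := size_hd s'i.
pose v := rcons (hd a s) (lst a M s); pose v' := rcons (hd a s') (lst a M s').
have ov : sorted ltn v := sorted_hd_lst si.
have ov' : sorted ltn v' := sorted_hd_lst s'i.
pose w := v ++ v'.
have vK z : z \in v -> z < K.
  rewrite /v mem_rcons inE => /predU1P[->|zh]; first by lia.
  move: ov; rewrite /v -cats1 sorted_catE => /and3P[/allrelP h _ _].
  by have := h z (lst a M s) zh (mem_head _ _); lia.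
have v'K z : z \in v' -> K <= z.
  have hK y : y \in hd a s' -> K <= y by rewrite hE => /mapP[i _ ->]; rewrite leq_addr.
  rewrite /v' mem_rcons inE => /predU1P[->|/hK//].
  move: ov'; rewrite /v' -cats1 sorted_catE => /and3P[/allrelP h _ _].
  case hsE : (hd a s') sh' => [|y z'] ea; first by move: a0; rewrite -ea.
  have yh : y \in hd a s' by rewrite hsE mem_head.
  exact: leq_trans (hK y yh) (ltnW (h _ _ yh (mem_head _ _))).
have ow : sorted ltn w by apply: (sorted_cat_bound ov ov' vK v'K).
have sw : size w = a.+1 + a.+1 by rewrite size_cat !size_rcons sh sh'.
have w_lt i j : i < j -> j < size w -> nth 0 w i < nth 0 w j.
  move=> ij js; apply: (sorted_ltn_nth ltn_trans) => //; rewrite inE //.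
  exact: ltn_trans ij js.
(* The ends keep their middle parts; in between, [y] is the interval right after the second to last
   entry of the window. *)
pose Y t := if t == 0 then md a M s else if t == a.+1 then md a M s'
  else iota (nth 0 w (t + a.-1)).+1 M.
pose x t := take a (drop t w) ++ Y t ++ [:: nth 0 w (t + a)].
have szT t : t <= a.+1 -> size (take a (drop t w)) = a.
  by move=> ta; rewrite size_takel // size_drop sw; lia.
have szY t : size (Y t) = M.
  by rewrite /Y; case: ifP => _; [|case: ifP => _]; rewrite ?size_md ?size_iota.
have parts t : t <= a.+1 -> [/\ size (x t) = (a + M).+1, hd a (x t) = take a (drop t w),
    md a M (x t) = Y t & lst a M (x t) = nth 0 w (t + a)].
  by move=> ta; apply: join_vertex; rewrite ?szT.
have x0 : x 0 = s.
  rewrite [RHS](split_vertex si) /x /Y drop0 /w /v -cats1 -catA take_size_cat //= add0n.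
  by rewrite nth_cat sh ltnn subnn.
have xS : x a.+1 = s'.
  rewrite [RHS](split_vertex s'i) /x /Y eqxx drop_size_cat; last by rewrite size_rcons sh.
  rewrite nth_cat size_rcons sh ltnNge leq_addr /= addKn /v' -cats1 take_size_cat //.
  by rewrite nth_cat sh' ltnn subnn.
(* The last entry of such a window lies in the head of [s'], whose spacing [M.+1], like the distance
   from [lst a M s] to [K], makes room for [y]. *)
have gap t : 0 < t <= a -> nth 0 w (t + a.-1) + M < nth 0 w (t + a).
  move=> /andP[t0 ta].
  have nw i : i < a -> nth 0 w (a.+1 + i) = K + i * M.+1.
    move=> ia; rewrite nth_cat size_rcons sh ltnNge leq_addr /= addKn /v' nth_rcons sh' ia hE.
    by rewrite nth_mkseq.
  have -> : t + a = a.+1 + t.-1 by lia.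
  rewrite nw; last by lia.
  case: t t0 ta => // -[|t] _ ta /=.
    have -> : 1 + a.-1 = a by lia.
    by rewrite nth_cat size_rcons sh leqnn nth_rcons sh ltnn eqxx; lia.
  have -> : t.+2 + a.-1 = a.+1 + t by lia.
  by rewrite nw ?mulSn; lia.
have xi t : t <= a.+1 -> increasing (a + M).+1 (x t).
  move=> ta; have [->|t0] := eqVneq t 0; first by rewrite x0.
  have [->|tS] := eqVneq t a.+1; first by rewrite xS.
  have [sx _ _ _] := parts t ta; rewrite /increasing sx eqxx /x /Y (negPf t0) (negPf tS) /=.
  have tw z : z \in take a (drop t w) -> z <= nth 0 w (t + a.-1).
    case/(nthP 0) => i; rewrite szT // => ia <-; rewrite nth_take // nth_drop.
    have [->//|ne] := eqVneq i a.-1; apply/ltnW/w_lt; rewrite ?sw; lia.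
  have gt := gap t; have := gt _; rewrite lt0n t0 /= => /(_ _) {}gt.
  have {}gt : nth 0 w (t + a.-1) + M < nth 0 w (t + a) by apply: gt; lia.
  apply: (@sorted_cat_bound _ _ (nth 0 w (t + a.-1)).+1) => //.
  - by apply: (subseq_sorted ltn_trans) ow; apply: subseq_trans (take_subseq _ _) (drop_subseq _ _).
  - apply: (@sorted_cat_bound _ _ (nth 0 w (t + a))); rewrite ?iota_ltn_sorted //.
      by move=> z; rewrite mem_iota; lia.
    by move=> z; rewrite inE => /eqP->.
  - by move=> z; rewrite mem_cat mem_iota inE => /orP[/andP[]//|/eqP->]; lia.
exists x; split=> // [i j ia ja xij|i ia].
- have hx t : t <= a.+1 -> head 0 (x t) = nth 0 w t.
    move=> ta; rewrite /x; have := szT t ta; case tE : (take _ _) => [|y z] //=.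
      by move=> e; move: a0; rewrite -e.
    by have := congr1 (fun u => nth 0 u 0) tE; rewrite nth_take // nth_drop addn0 => ->.
  have iw : i < size w by rewrite sw; lia.
  have jw : j < size w by rewrite sw; lia.
  have := congr1 (head 0) xij; rewrite !hx // => /eqP.
  by rewrite (nth_uniq _ iw jw (sorted_uniq ltn_trans ltnn ow)) => /eqP.
- rewrite /outer !xi //=; last exact: ltnW.
  have [_ -> _ _] := parts _ ia; have [_ -> _ ->] := parts _ (ltnW ia).
  rewrite -nth_drop -take_nth ?size_drop ?sw; last lia.
  by rewrite -[i.+1]add1n -drop_drop drop1 -!drop1 take_drop addn1.
Qed.

(** Red inner and blue outer edges are a good coloring: inner cliques have at most j + 1 = t - 1
    vertices, and l <= 2(a + 1). The choice a = l - 3 lets a + 1 outer steps and a new vertex close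
    a cycle of length l. *)
Lemma complete_odd_realizable (t l : nat) : 3 <= t -> 5 <= l -> odd l ->
  realizable (2 * (t - 1)) (complete t) (cycle_graph l).
Proof.
move=> t3 l5 ol; have [j tE] : exists j, t = j.+2 by exists (t - 2); lia.
have [a lE] : exists a, l = a.+3 by exists (l - 3); lia.
have a0 : 0 < a by lia.
have l3 : 3 <= l by lia.
pose M := j.*2; pose D := nested j.
have Dirr : irreflexive (step a M D) by apply: step_irrefl => //; apply: nested_irrefl.
exists (seq nat), (step a M D); split=> //.
  move/(_ [rel s s' | inner a M D s s' || inner a M D s' s]
          [rel s s' | outer a M s s' || outer a M s' s]).
  case.
  - by move=> s s'; rewrite /= orbC.
  - by move=> s s'; rewrite /= orbC.
  - by move=> s s' /= /orP[->|->] //; rewrite orbT.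
  - by move/(inner_complete (@nested_irrefl j))/nested_complete; rewrite tE ltnn.
  - by apply: (shift_no_odd_cycle (@outer_shift a M a0)) => //; lia.
move=> R B Rs Bs cov; apply: contrapT => /not_orP[noR noB].
have e_inj : injective (@inl (seq nat) (seq (seq nat) * nat)) := @inl_inj _ _.
have forced R' B' := @nested_forced j l R' B' l5.
have cov' s s' : step a M D s s' -> R (inl s) (inl s') || B (inl s) (inl s').
  by move=> ss'; apply: cov.
case: (forced_red_or_blue_outer a0 l3 (@nested_map j) (@nested_increasing j) (@nested_irrefl j)
    forced Rs Bs e_inj cov' noB) => [[f [f_inj _ fR]]|[g [g_homo gB]]].
  apply: noR; rewrite tE; exists (fun i => inl (f i)); split=> [x y [] /f_inj //|].
  exact: fR.
have clique h K := red_clique_in_copy a0 l3 (@nested_map j) (@nested_increasing j)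
    (@nested_irrefl j) forced Rs Bs e_inj cov' noB (h := h) (K := K) g_homo.
have [|q [q_inj qi qh qK qR]] := clique (iota 0 a) a (increasing_iota _ _).
  by move=> x; rewrite mem_iota.
(* The second copy lies so far beyond the first red clique, with its head so spaced, that
   [outer_path] joins any vertex of one clique to any of the other. *)
pose K := (\max_i lst a M (q i) + M).+1; pose h' := mkseq (fun i => K + i * M.+1) a.
have h'_inc : increasing a h'.
  rewrite /increasing size_mkseq eqxx; apply: sorted_mkseq => x y xy.
  by rewrite ltn_add2l ltn_pmul2r.
have [|q' [q'_inj q'i q'h q'K q'R]] := clique h' (K + a * M.+1) h'_inc.
  by move=> _ /mapP[i + ->]; rewrite mem_iota ltn_add2l ltn_pmul2r.
have qK' i : lst a M (q i) + M < K by rewrite ltnS leq_add2r (leq_bigmax i).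
pose v s : seq nat + seq (seq nat) * nat := inl (map g s).
have v_inj : injective v := inj_comp e_inj (inj_map (homo_ltn_inj g_homo)).
pose A := [seq map g (q i) | i <- enum 'I_j.+1] ++ [seq map g (q' i) | i <- enum 'I_j.+1].
pose u : seq nat + seq (seq nat) * nat := inr (A, 0).
have sz (f : 'I_j.+1 -> seq nat) : size [seq map g (f i) | i <- enum 'I_j.+1] = j.+1.
  by rewrite size_map size_enum_ord.
have uA s : s \in A -> R u (inl s) || B u (inl s).
  apply: (fresh_cover 0 Rs Bs cov).
  by rewrite size_cat !sz tE; lia.
have uq i : R u (v (q i)) || B u (v (q i)).
  by apply: uA; rewrite mem_cat; apply/orP; left; apply/mapP; exists i; rewrite ?mem_enum.
have uq' i : R u (v (q' i)) || B u (v (q' i)).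
  by apply: uA; rewrite mem_cat; apply/orP; right; apply/mapP; exists i; rewrite ?mem_enum.
have noBB i i' : B u (v (q i)) -> B u (v (q' i')) -> False.
  move=> ui ui'; have [x [x0 xS x_inj xP]] := outer_path a0 (qi i) (q'i i') (qK' i) (q'h i').
  apply: noB; rewrite lE; apply: (hcopy_cone_cycle (x := v \o x) (z := u)) => //.
  - by move=> b c ba ca /v_inj; apply: x_inj.
  - by move=> b ba; apply/gB/xP.
  - by rewrite /= x0.
  - by rewrite /= xS.
have noRq (f : 'I_j.+1 -> seq nat) : injective f ->
    (forall i i', i != i' -> R (v (f i)) (v (f i'))) -> ~ forall i, R u (v (f i)).
  move=> f_inj fR uR; apply: noR; rewrite tE.
  apply: (hcopy_complete_cone (f := fun i => v (f i)) (z := u)) => //.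
  by move=> i i' /v_inj/f_inj.
have pick (f : 'I_j.+1 -> seq nat) : injective f ->
    (forall i i', i != i' -> R (v (f i)) (v (f i'))) ->
    (forall i, R u (v (f i)) || B u (v (f i))) -> exists i, B u (v (f i)).
  move=> f_inj fR uf; apply: contrapT => /forallNP noBf; apply: (noRq f f_inj fR) => i.
  by case/orP: (uf i) => // /noBf.
have [i ui] := pick q q_inj qR uq; have [i' ui'] := pick q' q'_inj q'R uq'.
exact: noBB ui ui'.
Qed.

(** * The values of s_2 *)

Lemma realizable_s_is (d : nat) (H1 H2 : sgraph) :
  (forall x : H1, exists y, edge x y) -> (forall x : H2, exists y, edge x y) ->
  realizable d H1 H2 ->
  (forall G, Ramsey_minimal (graph_pair H1 H2) G -> d <= min_degree G) ->
  s_is (graph_pair H1 H2) d.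
Proof.
move=> H1_deg H2_deg [V [E [E_irr notE arrU]]] lower; split=> //.
have [G [minG Gd]] := exists_minimal_small_degree E_irr H1_deg H2_deg notE arrU.
by exists G; split=> //; apply/eqP; rewrite eqn_leq Gd lower.
Qed.

Theorem theorem1p2 (t k l : nat) (ht : 3 <= t) (hk : 4 <= k) (hl : 4 <= l) :
  s_is (graph_pair (cycle_graph k) (cycle_graph l)) 3 /\
  s_is (graph_pair (complete t) (cycle_graph l)) (2 * (t - 1)).
Proof.
have [t2 k3 l3] : [/\ 2 <= t, 3 <= k & 3 <= l] by split; apply: ltnW.
split; apply: realizable_s_is => //; try exact: cycle_no_isolated.
- exact: cycles_realizable.
- by move=> G; apply: cycles_le_min_degree.
- exact: complete_no_isolated.
- have [ol|el] := boolP (odd l); last exact: complete_even_realizable.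
  by apply: complete_odd_realizable => //; lia.
- by move=> G; apply: complete_cycle_le_min_degree.
Qed.
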